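(* Let $\mu=a\omega_1+b\omega_2$ with $a,b\in\mathbb N$ and let $\lambda\in P^+_G(\mu)$. Then there are constants $b_{\lambda'}$ such that, as functions on $A=\{a_{\mathbf t}\}$, $$R^\mu(\Omega)Q^\mu_\lambda=c_\lambda Q^\mu_\lambda+\sum_{\lambda'\prec\lambda;\ \lambda'\in P^+_G(\mu)}b_{\lambda'}\,Q^\mu_{\lambda'}.$$
   Context: $\mathbb N=\{0,1,2,\dots\}$, $m>2$ an integer, $G=\mathrm{SU}(m+2)$, $K=\mathrm S(\mathrm U(2)\times\mathrm U(m))$. $\omega_1,\dots,\omega_{m+1}$ are the fundamental weights of $G$ for the standard simple roots $\alpha_1,\dots,\alpha_{m+1}$ of type $\mathrm A_{m+1}$, so $\alpha_i=-\omega_{i-1}+2\omega_i-\omega_{i+1}$ with $\omega_0=\omega_{m+2}=0$. Partial order: $\lambda'\preccurlyeq\lambda$ iff $\lambda-\lambda'\in\bigoplus_i\mathbb N\alpha_i$; $\lambda'\prec\lambda$ means in addition $\lambda'\ne\lambda$. $\lambda_1=\omega_1+\omega_{m+1}$, $\lambda_2=\omega_2+\omega_m$. For $\mu=a\omega_1+b\omega_2$ (highest weight of the irreducible $K$-representation $V^K_\mu$ of dimension $a+1$), $\nu_i=(a-i)\omega_1+(i+b)\omega_2+i\omega_{m+1}$, $0\le i\le a$, and $P_G^+(\mu)$, the set of dominant weights $\lambda$ of $G$ such that $V^K_\mu$ occurs in $V^G_\lambda|_K$, consists of the $\lambda=\nu_i+d_1\lambda_1+d_2\lambda_2$ with $0\le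 i\le a$, $d_1,d_2\in\mathbb N$ (uniquely determined by $\lambda$). $c_\lambda=\langle\lambda,\lambda\rangle+2\langle\lambda,\rho\rangle$, with $\rho$ half the sum of the positive roots and $\langle\cdot,\cdot\rangle$ the Weyl-invariant form with $\langle\alpha,\alpha\rangle=2$ for roots. $V^K_\mu$ has basis $F_1^k\cdot v_\mu$, $0\le k\le a$ ($v_\mu$ highest weight vector, $F_1=E_{2,1}$). Functions $A\to\mathrm{End}_M(V^K_\mu)$ (with $M=Z_K(A)$) are identified with tuples $(G_k)_{k=0}^a$ of scalar functions of $(t_1,t_2)$, where $G_k$ is the scalar by which the value at $a_{\mathbf t}$ acts on $F_1^k\cdot v_\mu$. The functions $Q^\mu_\lambda$ on $A$, $\lambda=\nu_i+d_1\lambda_1+d_2\lambda_2$, have components $$(Q^\mu_\lambda)_k=(\cos^2t_1+\cos^2t_2)^{d_1}(\cos^2t_1\cos^2t_2)^{d_2}\,q^\mu_{\nu_i,\sigma_k},$$ $$q^\mu_{\nu_i,\sigma_k}=(\cos t_1)^{a+b-k}\sum_{p=0}^{\min(i,k)}\frac{(-i)_p(-k)_p}{p!\,(-a)_p}(\cos^2t_2-\cos^2t_1)^p(\cos t_2)^{b+2i+k-2p}.$$ $R^\mu(\Omega)$ is the radial part of the Casimir operator, acting (where the denominators are nonzero) by $$(R^\mu(\Omega)G)_k=\tfrac{1}{2(m+2)}\bigl(m(a+b-k)^2-4(a+b-k)(b+k)+m(b+k)^2\bigr)G_k-\tfrac12\sum_{p=1}^2\frac{\partial^2G_k}{\partial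 t_p^2}-(m-2)\sum_{p=1}^2\frac{\cos t_p}{\sin t_p}\frac{\partial G_k}{\partial t_p}$$ $$-\frac{\cos(t_1+t_2)}{\sin(t_1+t_2)}\Bigl(\frac{\partial G_k}{\partial t_1}+\frac{\partial G_k}{\partial t_2}\Bigr)-\frac{\cos(t_1-t_2)}{\sin(t_1-t_2)}\Bigl(\frac{\partial G_k}{\partial t_1}-\frac{\partial G_k}{\partial t_2}\Bigr)$$ $$-\Bigl(\frac{\cos(t_1+t_2)}{\sin^2(t_1+t_2)}+\frac{\cos(t_1-t_2)}{\sin^2(t_1-t_2)}\Bigr)\bigl((k+1)(a-k)G_{k+1}+k(a-k+1)G_{k-1}\bigr)$$ $$+\Bigl(\frac1{\sin^2(t_1+t_2)}+\frac1{\sin^2(t_1-t_2)}\Bigr)\bigl((k+1)(a-k)+k(a-k+1)\bigr)G_k$$ $$-\sum_{p=1}^2\frac{\cos(2t_p)}{\sin(2t_p)}\frac{\partial G_k}{\partial t_p}+\frac{(a+b-k)^2}{2\cos^2t_1}G_k+\frac{(b+k)^2}{2\cos^2t_2}G_k.$$ *)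

(* Defs.v *)
From HB Require Import structures.
From mathcomp Require Import all_boot all_order all_algebra perm.
From mathcomp Require Import all_classical all_reals all_analysis.
From mathcomp Require Import ring lra zify.

Set Implicit Arguments.
Unset Strict Implicit.
Unset Printing Implicit Defensive.

Import Order.TTheory GRing.Theory Num.Theory.
Import numFieldNormedType.Exports.

Local Open Scope classical_set_scope.
Local Open Scope ring_scope.

(* Weights of SU(m+2) are realised in the trace-zero hyperplane of R^(m+2), on
   which the dot product is the Weyl-invariant form with <alpha, alpha> = 2.
   The indices of eps, alpha and omega are the 1-based indices of the
   mathematical notation, whereas the columns of a row vector start at 0. *)
Section Weights.
Variables (R : realType) (m : nat).
Implicit Types u v w l : 'rV[R]_m.+2.

Definition dot u v : R := (u *m v^T) 0 0.

Definition eps (j : nat) : 'rV[R]_m.+2 := \row_(c < m.+2) (c.+1 == j)%:R.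

Definition alpha (i : nat) : 'rV[R]_m.+2 := eps i - eps i.+1.

(* eps_1 + ... + eps_i, projected to the trace-zero hyperplane *)
Definition omega (i : nat) : 'rV[R]_m.+2 :=
  \row_(c < m.+2) ((c < i)%N%:R - i%:R / m.+2%:R).

Definition rho : 'rV[R]_m.+2 :=
  2^-1 *: \sum_(1 <= i < m.+3) \sum_(i.+1 <= j < m.+3) (eps i - eps j).

Definition casimir_eigenvalue l : R := dot l l + 2 * dot l rho.

Definition preceq l' l : Prop :=
  exists n : nat -> nat, l - l' = \sum_(1 <= i < m.+2) alpha i *+ n i.

Definition prec l' l : Prop := preceq l' l /\ l' <> l.

Definition lambda1 : 'rV[R]_m.+2 := omega 1 + omega m.+1.
Definition lambda2 : 'rV[R]_m.+2 := omega 2 + omega m.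

(* The K-type is mu = a omega_1 + b omega_2. *)
Definition nu (a b i : nat) : 'rV[R]_m.+2 :=
  omega 1 *+ (a - i) + omega 2 *+ (i + b) + omega m.+1 *+ i.

Definition weight_of (a b : nat) (x : nat * nat * nat) : 'rV[R]_m.+2 :=
  nu a b x.1.1 + lambda1 *+ x.1.2 + lambda2 *+ x.2.

(* P_G^+(mu), through its description by the triples (i, d1, d2). *)
Definition PGplus (a b : nat) : set 'rV[R]_m.+2 :=
  [set l | exists i d1 d2 : nat, (i <= a)%N /\ l = weight_of a b (i, d1, d2)].

(* The triple (i, d1, d2) of a weight in P_G^+(mu); see weight_paramE. *)
Definition weight_param (a b : nat) l : nat * nat * nat :=
  xget (0%N, 0%N, 0%N) [set x | (x.1.1 <= a)%N /\ l = weight_of a b x].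

Lemma dotDl u v w : dot (u + v) w = dot u w + dot v w.
Proof. by rewrite /dot mulmxDl mxE. Qed.

Lemma dotC u v : dot u v = dot v u.
Proof. by rewrite /dot !mxE; apply: eq_bigr => i _; rewrite !mxE mulrC. Qed.

Lemma dotDr u v w : dot w (u + v) = dot w u + dot w v.
Proof. by rewrite dotC dotDl !(dotC _ w). Qed.

Lemma dotNl u w : dot (- u) w = - dot u w.
Proof. by rewrite /dot mulNmx mxE. Qed.

Lemma dotNr u w : dot w (- u) = - dot w u.
Proof. by rewrite dotC dotNl dotC. Qed.

Lemma dot0l w : dot 0 w = 0.
Proof. by rewrite /dot mul0mx mxE. Qed.

Lemma dotMnl u w n : dot (u *+ n) w = dot u w *+ n.
Proof. by elim: n => [|n IH]; rewrite ?mulr0n ?dot0l // !mulrS dotDl IH. Qed.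

Lemma dot_eps u (c : 'I_m.+2) : dot u (eps c.+1) = u 0 c.
Proof.
rewrite /dot mxE (bigD1 c) //= big1 => [|i ic].
  by rewrite !mxE eqxx mulr1 addr0.
by rewrite !mxE eqSS (negbTE (ic : val i != val c)) mulr0.
Qed.

Lemma dot_epsE u j (lej : (j < m.+2)%N) : dot u (eps j.+1) = u 0 (Ordinal lej).
Proof. exact: (dot_eps u (Ordinal lej)). Qed.

Lemma dot_omega_alpha i j : (0 < j < m.+2)%N ->
  dot (omega i) (alpha j) = (i == j)%:R.
Proof.
case: j => // j /= jm; rewrite /alpha dotDr dotNr.
have jm' : (j < m.+2)%N by lia.
rewrite (dot_epsE _ jm') (dot_epsE _ jm) !mxE /=.
have -> : (i == j.+1)%:R = (j < i)%N%:R - (j.+1 < i)%N%:R :> R.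
  by rewrite -natrB; [congr (_%:R)|]; lia.
by ring.
Qed.

Lemma alphaE i : (0 < i < m.+2)%N ->
  alpha i = - omega i.-1 + omega i *+ 2 - omega i.+1.
Proof.
case: i => // i /= im; apply/rowP => c; rewrite !mxE /=.
have -> : (c.+1 == i.+1)%:R = (c < i.+1)%N%:R - (c < i)%N%:R :> R.
  by rewrite -natrB; [congr (_%:R)|]; lia.
have -> : (c.+1 == i.+2)%:R = (c < i.+2)%N%:R - (c < i.+1)%N%:R :> R.
  by rewrite -natrB; [congr (_%:R)|]; lia.
by rewrite -!(natr1 i) -!natr1; field; rewrite !natr1 pnatr_eq0.
Qed.

(* Invariance under the Weyl group, the symmetric group on the coordinates. *)
Lemma dot_perm (s : {perm 'I_m.+2}) u v : dot (col_perm s u) (col_perm s v) = dot u v.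
Proof.
rewrite /dot !mxE [RHS](reindex_inj (@perm_inj _ s)).
by apply: eq_bigr => i _; rewrite !mxE.
Qed.

Lemma dot_alpha i : (0 < i < m.+2)%N -> dot (alpha i) (alpha i) = 2.
Proof.
move=> im; rewrite {1}alphaE // !dotDl !dotNl !dot_omega_alpha //.
have -> : (i.-1 == i) = false by lia.
have -> : (i.+1 == i) = false by lia.
by rewrite eqxx /=; ring.
Qed.

Lemma dot_weight_of a b x j : (0 < j < m.+2)%N ->
  dot (weight_of a b x) (alpha j) =
  ((a - x.1.1 + x.1.2) * (j == 1) + (x.1.1 + b + x.2) * (j == 2) +
   x.2 * (j == m) + (x.1.1 + x.1.2) * (j == m.+1))%N%:R.
Proof.
move=> jm; rewrite /weight_of /nu /lambda1 /lambda2 !(dotDl, dotMnl).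
rewrite !dot_omega_alpha // !(eq_sym _ j) -!natrD.
rewrite -!mulrnA -!natrD; congr (_%:R).
by case: (j == 1)%N (j == 2)%N (j == m) (j == m.+1) => [] [] [] []; lia.
Qed.

Lemma weight_of_inj a b x y : (2 < m)%N ->
  (x.1.1 <= a)%N -> (y.1.1 <= a)%N -> weight_of a b x = weight_of a b y ->
  x = y.
Proof.
case: x y => [[i d1] d2] [[i' d1'] d2'] /= m2 ia i'a e.
have d j : (0 < j < m.+2)%N -> _ := fun h => etrans (esym
  (dot_weight_of a b (i, d1, d2) h)) (etrans (congr1 (dot ^~ (alpha j)) e)
  (dot_weight_of a b (i', d1', d2') h)).
have b2 : (0 < 2 < m.+2)%N by lia.
have bm : (0 < m < m.+2)%N by lia.
have bm1 : (0 < m.+1 < m.+2)%N by lia.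
have natI (p q : nat) : p%:R = q%:R :> R -> p = q.
  by move/eqP; rewrite eqr_nat => /eqP.
move: (natI _ _ (d _ b2)) (natI _ _ (d _ bm)) (natI _ _ (d _ bm1)) => /=.
rewrite !eqxx.
have -> : (m == 1)%N = false by lia.
have -> : (m == 2)%N = false by lia.
have -> : (m == m.+1)%N = false by lia.
have -> : (m.+1 == 1)%N = false by lia.
have -> : (m.+1 == 2)%N = false by lia.
have -> : (m.+1 == m)%N = false by lia.
have -> : (2 == m)%N = false by lia.
have -> : (2 == m.+1)%N = false by lia.
by move=> h1 h2 h3; congr (_, _, _); lia.
Qed.

Lemma weight_paramE a b i d1 d2 : (2 < m)%N -> (i <= a)%N ->
  weight_param a b (weight_of a b (i, d1, d2)) = (i, d1, d2).
Proof.
move=> m2 ia; apply: xget_unique => //= y [ya].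
by move=> /esym /weight_of_inj; apply.
Qed.

Lemma dot_omega_theta i : (0 < i < m.+2)%N ->
  dot (omega i) (eps 1 - eps m.+2) = 1.
Proof.
move=> im; rewrite dotDr dotNr.
rewrite (dot_epsE _ (ltn0Sn _)) (dot_epsE _ (ltnSn _)) !mxE /=.
have -> : (0 < i)%N by lia.
have -> : (m.+1 < i)%N = false by lia.
by rewrite /=; ring.
Qed.

Lemma dot_alpha_theta_ge0 i : (0 < i < m.+2)%N ->
  0 <= dot (alpha i) (eps 1 - eps m.+2).
Proof.
move=> im; rewrite dotDr dotNr.
rewrite (dot_epsE _ (ltn0Sn _)) (dot_epsE _ (ltnSn _)) !mxE /=.
have -> : (1 == i.+1)%N = false by lia.
have -> : (m.+2 == i)%N = false by lia.
by rewrite subr0 sub0r opprK addr_ge0 ?ler0n.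
Qed.

Lemma preceq_theta l' l : preceq l' l ->
  dot l' (eps 1 - eps m.+2) <= dot l (eps 1 - eps m.+2).
Proof.
move=> [n ln]; rewrite -subr_ge0 -dotNl -dotDl ln.
rewrite big_nat; elim/big_ind: _ => [|u v u0 v0|i im].
- by rewrite dot0l.
- by rewrite dotDl addr_ge0.
- by rewrite dotMnl mulrn_wge0// dot_alpha_theta_ge0.
Qed.

Lemma finite_PGplus_prec a b l : (2 < m)%N ->
  finite_set [set l' | prec l' l /\ PGplus a b l'].
Proof.
move=> m2; pose N := Num.bound (dot l (eps 1 - eps m.+2)).
apply: (@sub_finite_set _ _
  (weight_of a b @` (`I_a.+1 `*` `I_N `*` `I_N))); last first.
  apply: finite_image; apply: finite_setX; last exact: finite_II.
  by apply: finite_setX; exact: finite_II.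
move=> l' [[/preceq_theta le_l _] [i [d1 [d2 [ia l'E]]]]].
exists (i, d1, d2) => //=.
have d12 : (d1 + d2)%:R <= dot l' (eps 1 - eps m.+2).
  rewrite l'E /weight_of /nu /lambda1 /lambda2 !(dotDl, dotMnl) /=.
  rewrite !dot_omega_theta; [|lia..].
  by rewrite -mulr2n -!mulrnA -!natrD ler_nat; lia.
have d0 := le_trans (ler0n R (d1 + d2)) d12.
have := le_lt_trans (le_trans d12 le_l) (archi_boundP (le_trans d0 le_l)).
by rewrite ltr_nat /N /=; lia.
Qed.

End Weights.

Section Functions.
Variables (R : realType) (m a b : nat).
Implicit Types i k : nat.

Definition pochhammer (x : R) (p : nat) : R := \prod_(j < p) (x + j%:R).

(* For i, k <= a the subtractions on nat are exact. *)
Definition q_fun i k (t1 t2 : R) : R :=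
  cos t1 ^+ (a + b - k) *
  \sum_(p < (minn i k).+1)
    pochhammer (- i%:R) p * pochhammer (- k%:R) p
      / (p`!%:R * pochhammer (- a%:R) p)
    * (cos t2 ^+ 2 - cos t1 ^+ 2) ^+ p * cos t2 ^+ (b + 2 * i + k - 2 * p).

(* A tuple (G_k) with 0 <= k <= a is encoded as a family indexed by nat, of
   which only the components k <= a are relevant. *)
Definition Qfun (l : 'rV[R]_m.+2) k (t1 t2 : R) : R :=
  let: (i, d1, d2) := weight_param a b l in
  (cos t1 ^+ 2 + cos t2 ^+ 2) ^+ d1 * (cos t1 ^+ 2 * cos t2 ^+ 2) ^+ d2
  * q_fun i k t1 t2.

Lemma Qfun_weight_of i d1 d2 k (t1 t2 : R) : (2 < m)%N -> (i <= a)%N ->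
  Qfun (weight_of R m a b (i, d1, d2)) k t1 t2 =
  (cos t1 ^+ 2 + cos t2 ^+ 2) ^+ d1 * (cos t1 ^+ 2 * cos t2 ^+ 2) ^+ d2
  * q_fun i k t1 t2.
Proof. by move=> m2 ia; rewrite /Qfun weight_paramE. Qed.

Definition partial1 (n : nat) (f : R -> R -> R) (t1 t2 : R) : R :=
  derive1n n (fun s => f s t2) t1.
Definition partial2 (n : nat) (f : R -> R -> R) (t1 t2 : R) : R :=
  derive1n n (fun s => f t1 s) t2.

(* The values G (k.+1) for k = a and G (k.-1) for k = 0, which fall outside the
   tuple, occur with coefficient 0. *)
Definition radial_casimir (G : nat -> R -> R -> R) k (t1 t2 : R) : R :=
  let e1 : R := a%:R + b%:R - k%:R in
  let e2 : R := b%:R + k%:R in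
  let cup : R := (k%:R + 1) * (a%:R - k%:R) in
  let cdown : R := k%:R * (a%:R - k%:R + 1) in
  let g := G k in
  (2 * (m%:R + 2))^-1 * (m%:R * e1 ^+ 2 - 4 * e1 * e2 + m%:R * e2 ^+ 2)
    * g t1 t2
  - 2^-1 * (partial1 2 g t1 t2 + partial2 2 g t1 t2)
  - (m%:R - 2) * (cos t1 / sin t1 * partial1 1 g t1 t2
                  + cos t2 / sin t2 * partial2 1 g t1 t2)
  - cos (t1 + t2) / sin (t1 + t2) * (partial1 1 g t1 t2 + partial2 1 g t1 t2)
  - cos (t1 - t2) / sin (t1 - t2) * (partial1 1 g t1 t2 - partial2 1 g t1 t2)
  - (cos (t1 + t2) / sin (t1 + t2) ^+ 2 + cos (t1 - t2) / sin (t1 - t2) ^+ 2)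
    * (cup * G k.+1 t1 t2 + cdown * G k.-1 t1 t2)
  + ((sin (t1 + t2) ^+ 2)^-1 + (sin (t1 - t2) ^+ 2)^-1)
    * (cup + cdown) * g t1 t2
  - (cos (2 * t1) / sin (2 * t1) * partial1 1 g t1 t2
     + cos (2 * t2) / sin (2 * t2) * partial2 1 g t1 t2)
  + e1 ^+ 2 / (2 * cos t1 ^+ 2) * g t1 t2
  + e2 ^+ 2 / (2 * cos t2 ^+ 2) * g t1 t2.

End Functions.

Definition regular (R : realType) (t1 t2 : R) : Prop :=
  [/\ sin (2 * t1) != 0, sin (2 * t2) != 0, sin (t1 + t2) != 0
    & sin (t1 - t2) != 0].

(* All the denominators of radial_casimir are nonzero at a regular point. *)
Lemma regular_sin_cos (R : realType) (t1 t2 : R) : regular t1 t2 ->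
  [/\ sin t1 != 0, sin t2 != 0, cos t1 != 0 & cos t2 != 0].
Proof.
have s2 (t : R) : sin (2 * t) = 2 * sin t * cos t.
  by rewrite mulr_natl mulr2n sinD; ring.
case; rewrite !s2 !mulf_eq0 !negb_or => /andP[/andP[_ ? ?]].
by case/andP => /andP[_ ? ?].
Qed.

(* Main.v *)
(* With x = cos^2 t1 and y = cos^2 t2, the k-th component of Q_(nu_i) is
   cos^(a+b-k) t1 cos^(b+k) t2 w_i / C(a, i), where w_i is the coefficient of
   z^i in (1 + xz)^k (1 + yz)^(a-k).  From the generating polynomial,
     x d_x w_i + y d_y w_i = i w_i,   d_x w_i + d_y w_i = (a - i + 1) w_(i-1),
     (i + 1) w_(i+1) = (kx + (a-k)y) w_i - (x^2 d_x w_i + y^2 d_y w_i),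
   and the neighbouring components k + 1 and k - 1 are expressed through d_y w_i
   and d_x w_i.  Hence, away from x = y, all derivatives of w_i are combinations
   of w_i and w_(i-1), and a computation in the field of rational functions
   gives, with E_(i,d1,d2) = C(a, i) Q_(nu_i + d1 lambda_1 + d2 lambda_2),
     R(Omega) E_(i,d1,d2) = c_lambda E_(i,d1,d2)
       - 2 d1 (a-i+1) E_(i-1,d1-1,d2+1) - 2 d1 (i+1) E_(i+1,d1-1,d2)
       - 4 d1 (d1-1) E_(i,d1-2,d2+1)    - 2 d2 (i+1) E_(i+1,d1,d2-1)
       - 2 (a-i+1) (b+i+d2) E_(i-1,d1,d2)
       - 2 d2 (b+i+d2) E_(i,d1+1,d2-1)
       - 2 d1 (d1+2i+a+2b+4d2+3) E_(i,d1-1,d2).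
   The seven weights on the right are lower than lambda: the differences are
   sums of positive roots, in order eps_(m+1) - eps_(m+2), eps_1 - eps_2, the
   sum of these two, eps_1 - eps_(m+1), eps_2 - eps_(m+2),
   eps_2 - eps_(m+1) and eps_1 - eps_(m+2). *)

Require Import Defs.
From mathcomp Require Import all_boot all_order all_algebra.
From mathcomp Require Import all_classical all_reals all_analysis.
From mathcomp Require Import ring zify.

Set Implicit Arguments.
Unset Strict Implicit.
Unset Printing Implicit Defensive.

Import Order.TTheory GRing.Theory Num.Theory.
Import numFieldNormedType.Exports.

Local Open Scope classical_set_scope.
Local Open Scope ring_scope.

(** * Coefficients of the generating polynomial *)

Section GeneratingPolynomial.
Variable R : realType.
Implicit Types (x y : R) (s k l i : nat).

Definition genpoly k l x y : {poly R} :=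
  (1 + x%:P * 'X) ^+ k * (1 + y%:P * 'X) ^+ l.

(* The shift by s makes this the coefficient of index i - s, and 0 if i < s, so
   that w_(i-1) needs no truncated subtraction. *)
Definition elem s k l i x y : R := ('X^s * genpoly k l x y)`_i.

Lemma genpolyC k l x y : genpoly k l x y = genpoly l k y x.
Proof. by rewrite /genpoly mulrC. Qed.

Lemma elemC s k l i x y : elem s k l i x y = elem s l k i y x.
Proof. by rewrite /elem genpolyC. Qed.

Lemma elemS s k l i x y : elem s.+1 k l i.+1 x y = elem s k l i x y.
Proof. by rewrite /elem exprS -mulrA coefXM. Qed.

Lemma elem_lt s k l i x y : (i < s)%N -> elem s k l i x y = 0.
Proof. by move=> lis; rewrite /elem coefXnM lis. Qed.

(** The generating polynomial has degree at most [k + l]. For [k + l = a] this removes the terms of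
    index [a + 1], to which no weight of [PGplus] corresponds. *)
Lemma elem_gt k l i x y : (k + l < i)%N -> elem 0 k l i x y = 0.
Proof.
move=> kli; rewrite /elem expr0 mul1r nth_default //.
have sz z : (size (1 + z%:P * 'X : {poly R})%R <= 2)%N.
  rewrite addrC -[1]/(1%:P) size_MXaddC; case: ifP => // _.
  by rewrite ltnS size_polyC leq_b1.
have szX z n : (size ((1 + z%:P * 'X : {poly R}) ^+ n)%R <= n.+1)%N.
  rewrite (leq_trans (size_poly_exp_leq _ _)) // ltnS.
  by have := sz z; case: (size _) => [|[|[|]]]//=; rewrite ?mul1n ?mul0n//.
rewrite (leq_trans (size_polyMleq _ _)) //.
by have := szX x k; have := szX y l; lia.
Qed.

(** The factor [k] makes the truncation of [k.-1] at [k = 0] harmless; the device recurs with the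
    other lowered exponents. *)
Lemma mulrn_genpolyl k l x y :
  k%:R * genpoly k l x y = k%:R * genpoly k.-1 l x y * (1 + x%:P * 'X).
Proof.
case: k => [|k]; first by rewrite !mul0r.
by rewrite /genpoly /= exprS; ring.
Qed.

Lemma mulrn_genpolyr k l x y :
  l%:R * genpoly k l x y = l%:R * genpoly k l.-1 x y * (1 + y%:P * 'X).
Proof. by rewrite genpolyC mulrn_genpolyl genpolyC. Qed.

Lemma deriv_genpoly k l x y : (genpoly k l x y)^`() =
  k%:R * x%:P * genpoly k.-1 l x y + l%:R * y%:P * genpoly k l.-1 x y.
Proof.
have dX z n : ((1 + z%:P * 'X : {poly R}) ^+ n)^`() =
    n%:R * z%:P * (1 + z%:P * 'X) ^+ n.-1.
  by rewrite deriv_exp !poly.derivE -mulr_natl; ring.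
by rewrite /genpoly derivM !dX; ring.
Qed.

Lemma coefMnatl n (p : {poly R}) i : (n%:R * p)`_i = n%:R * p`_i.
Proof. by rewrite -polyC_natr coefCM. Qed.

(* k elem(s+1, k-1, l) and l elem(s+1, k, l-1) are the partial derivatives of
   elem(s, k, l) in x and y. *)
Lemma elem_Euler s k l i x y :
  x * (k%:R * elem s.+1 k.-1 l i x y) + y * (l%:R * elem s.+1 k l.-1 i x y) =
  (i%:R - s%:R) * elem s k l i x y.
Proof.
have XD (p : {poly R}) : ('X * p^`())`_i = i%:R * p`_i.
  rewrite coefXM; case: i => [|i] /=; first by rewrite mul0r.
  by rewrite coef_deriv mulr_natl.
have XE : 'X * ('X^s * genpoly k l x y)%R^`() =
    s%:R * ('X^s * genpoly k l x y) +
    (x%:P * (k%:R * ('X^(s.+1) * genpoly k.-1 l x y)) +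
     y%:P * (l%:R * ('X^(s.+1) * genpoly k l.-1 x y))).
  rewrite derivM deriv_genpoly derivXn exprS.
  have -> : 'X^(s.-1) *+ s * genpoly k l x y = s%:R * 'X^(s.-1) * genpoly k l x y.
    by rewrite mulr_natl.
  case: s => [|s]; first by rewrite !mul0r; ring.
  by rewrite /= exprS; ring.
have := congr1 (fun p : {poly R} => p`_i) XE.
rewrite XD !coefD !coefCM !coefMnatl /elem => e.
by rewrite mulrBl e; ring.
Qed.

(** With P for [genpoly], substituting [k P_(k-1,l) = k P_(k,l) - x X k P_(k-1,l)] and its analogue
    in [y] leaves the Euler identity at [s + 1]. *)
Lemma elem_translate s k l i x y :
  k%:R * elem s.+1 k.-1 l i x y + l%:R * elem s.+1 k l.-1 i x y =
  (k%:R + l%:R + 1 - (i%:R - s%:R)) * elem s.+1 k l i x y.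
Proof.
have e := elem_Euler s.+1 k l i x y.
have -> : (k%:R + l%:R + 1 - (i%:R - s%:R)) * elem s.+1 k l i x y =
  k%:R * elem s.+1 k l i x y + l%:R * elem s.+1 k l i x y -
  (i%:R - s.+1%:R) * elem s.+1 k l i x y by rewrite -natr1; ring.
rewrite -e /elem -!(coefMnatl, coefCM) -!(coefB, coefD); congr ((polyseq _)`_i).
rewrite !(mulrCA _%:R 'X^_) mulrn_genpolyl mulrn_genpolyr !(exprS _ s.+1).
by ring.
Qed.

(** The same substitution is made in the left side of the Euler identity. *)
Lemma elem_recurrence s k l i x y :
  (i%:R - s%:R) * elem s k l i x y =
  (k%:R * x + l%:R * y) * elem s.+1 k l i x y -
  (x ^+ 2 * (k%:R * elem s.+2 k.-1 l i x y) +
   y ^+ 2 * (l%:R * elem s.+2 k l.-1 i x y)).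
Proof.
rewrite -elem_Euler.
have -> : (k%:R * x + l%:R * y) * elem s.+1 k l i x y =
  x * (k%:R * elem s.+1 k l i x y) + y * (l%:R * elem s.+1 k l i x y) by ring.
rewrite /elem -!(coefMnatl, coefCM) -!(coefB, coefD); congr ((polyseq _)`_i).
rewrite !(mulrCA _%:R 'X^_) mulrn_genpolyl mulrn_genpolyr !(exprS _ s.+1).
by rewrite !polyC_exp; ring.
Qed.

(** One factor is exchanged through [1 + x X = (1 + y X) + (x - y) X]; this gives the component
    [k + 1] from the component [k] and its derivative in [y]. *)
Lemma elem_shift_left s k l i x y : l%:R * elem s k.+1 l.-1 i x y =
  l%:R * elem s k l i x y + (x - y) * (l%:R * elem s.+1 k l.-1 i x y).
Proof.
rewrite /elem -!(coefMnatl, coefCM) -!(coefB, coefD); congr ((polyseq _)`_i).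
rewrite !(mulrCA _%:R 'X^_) mulrn_genpolyr /genpoly (exprS _ k) exprS polyCB.
by ring.
Qed.

Lemma elem_shift_right s k l i x y : k%:R * elem s k.-1 l.+1 i x y =
  k%:R * elem s k l i x y + (y - x) * (k%:R * elem s.+1 k.-1 l i x y).
Proof. by rewrite !(elemC _ _ _ _ x); exact: elem_shift_left. Qed.

Lemma is_derive_elem s k l i x y :
  is_derive x 1 (fun z => elem s k l i z y) (k%:R * elem s.+1 k.-1 l i x y).
Proof.
(* The induction treats all [s] at once, since splitting off a factor [1 + z X] involves [s] and
   [s + 1]. *)
elim: k s i x => [|k IHk] s i x.
  rewrite mul0r; have -> : (fun z => elem s 0 l i z y) = cst (elem s 0 l i 0 y).
    by apply/funext => z; rewrite /elem /genpoly !expr0.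
  exact: is_derive_cst.
have eS s' z : elem s' k.+1 l i z y = elem s' k l i z y + z * elem s'.+1 k l i z y.
  rewrite /elem -coefCM -coefD /genpoly !exprS; congr ((polyseq _)`_i); ring.
have -> : (fun z => elem s k.+1 l i z y) =
    (fun z => elem s k l i z y) + (@id R) * (fun z => elem s.+1 k l i z y).
  by apply/funext => z; rewrite eS.
have d0 := IHk s i x; have d1 := IHk s.+1 i x.
apply: is_derive_eq.
rewrite /GRing.scale /= mulr1 -natr1.
have -> : k%:R * elem s.+1 k.-1 l i x y +
  (x * (k%:R * elem s.+2 k.-1 l i x y) + elem s.+1 k l i x y) =
  k%:R * (elem s.+1 k.-1 l i x y + x * elem s.+2 k.-1 l i x y) +
  elem s.+1 k l i x y by ring.
rewrite mulrDl mul1r; congr (_ + _).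
rewrite /elem -coefCM -coefD -!coefMnatl; congr ((polyseq _)`_i).
by rewrite !(mulrCA _%:R 'X^_) mulrn_genpolyl !(exprS _ s.+1); ring.
Qed.

End GeneratingPolynomial.

(** * Derivatives along cos t *)

Section Derivatives.
Variable R : realType.

Lemma is_derive_pow (n : nat) (x : R) :
  is_derive x 1 (fun z => z ^+ n) (n%:R * x ^+ n.-1).
Proof.
have d := is_deriveX n (is_derive_id x (1 : R)).
have -> : (fun z : R => z ^+ n) = (@id R) ^+ n.
  by apply/funext => z; rewrite fctE.
by apply: is_derive_eq; rewrite /GRing.scale /= mulr1.
Qed.

Lemma is_derive_comp_sqr (F : R -> R) (dF x : R) :
  is_derive (x ^+ 2) 1 F dF ->
  is_derive x 1 (fun z => F (z ^+ 2)) (2 * x * dF).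
Proof.
move=> dF2; have d := @is_derive1_comp _ F (fun z => z ^+ 2) _ _ _ dF2
  (is_derive_pow 2 x).
by apply: (is_derive_eq d); rewrite /= expr1; ring.
Qed.

Lemma is_derive_powM_comp_sqr (e : nat) (F : R -> R) (dF x : R) :
  is_derive (x ^+ 2) 1 F dF ->
  is_derive x 1 (fun z => z ^+ e * F (z ^+ 2))
    (e%:R * x ^+ e.-1 * F (x ^+ 2) + 2 * x ^+ e.+1 * dF).
Proof.
move=> /is_derive_comp_sqr dF2.
have d := is_deriveM (is_derive_pow e x) dF2.
by apply: (is_derive_eq d); rewrite /GRing.scale /= (exprS _ e); ring.
Qed.

Section CosineVariable.
Variables (e : nat) (F dF ddF : R -> R).
Hypotheses (FE : forall x : R, is_derive x 1 F (dF x))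
  (dFE : forall x : R, is_derive x 1 dF (ddF x)).

Lemma derive1_cos_pow (t : R) :
  derive1 (fun s => cos s ^+ e * F (cos s ^+ 2)) t =
  - sin t * (e%:R * cos t ^+ e.-1 * F (cos t ^+ 2) +
             2 * cos t ^+ e.+1 * dF (cos t ^+ 2)).
Proof.
have d := is_derive1_comp (is_derive_powM_comp_sqr e (FE (cos t ^+ 2)))
  (is_derive_cos t).
by rewrite derive1E (derive_val (is_derive := d)) mulrC.
Qed.

Lemma derive1n1_cos_pow (t : R) : cos t != 0 ->
  derive1n 1 (fun s => cos s ^+ e * F (cos s ^+ 2)) t =
  - (sin t / cos t) * cos t ^+ e *
    (e%:R * F (cos t ^+ 2) + 2 * cos t ^+ 2 * dF (cos t ^+ 2)).
Proof.
move=> ct; rewrite /derive1n /= derive1_cos_pow (exprS _ e).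
by case: e => [|e'] /=; rewrite ?(exprS _ e'); field.
Qed.

Lemma derive1n2_cos_pow (t : R) : cos t != 0 ->
  derive1n 2 (fun s => cos s ^+ e * F (cos s ^+ 2)) t =
  cos t ^+ e * ((1 - cos t ^+ 2) *
    (e%:R * (e%:R - 1) / cos t ^+ 2 * F (cos t ^+ 2) +
     (4 * e%:R + 2) * dF (cos t ^+ 2) +
     4 * cos t ^+ 2 * ddF (cos t ^+ 2)) -
    e%:R * F (cos t ^+ 2) - 2 * cos t ^+ 2 * dF (cos t ^+ 2)).
Proof.
move=> ct; rewrite /derive1n /=.
(* This form has no division by the cosine, so it is an identity of functions on the whole line and
   can be differentiated again. *)
have -> : derive1 (fun s => cos s ^+ e * F (cos s ^+ 2)) =
    (fun s => - sin s * (e%:R * cos s ^+ e.-1 * F (cos s ^+ 2) +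
             2 * cos s ^+ e.+1 * dF (cos s ^+ 2))).
  by apply/funext => s; rewrite derive1_cos_pow.
have d0 := is_derive1_comp (is_derive_powM_comp_sqr e.-1 (FE (cos t ^+ 2)))
  (is_derive_cos t).
have d1 := is_derive1_comp (is_derive_powM_comp_sqr e.+1 (dFE (cos t ^+ 2)))
  (is_derive_cos t).
have d := is_deriveM (is_deriveN (is_derive_sin t))
  (is_deriveD (is_deriveZ e%:R d0) (is_deriveZ 2 d1)).
have -> : (fun s => - sin s * (e%:R * cos s ^+ e.-1 * F (cos s ^+ 2) +
             2 * cos s ^+ e.+1 * dF (cos s ^+ 2))) =
   (- sin) * (e%:R *: ((fun z => z ^+ e.-1 * F (z ^+ 2)) \o cos) +
     2 *: ((fun z => z ^+ e.+1 * dF (z ^+ 2)) \o cos)).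
  by apply/funext => s; rewrite !fctE /= /GRing.scale /= !mulrA.
rewrite derive1E (derive_val (is_derive := d)) !fctE /= /GRing.scale /=.
have -> : 1 - cos t ^+ 2 = sin t ^+ 2 by rewrite sin2cos2.
by case: e => [|[|n]] /=;
  rewrite ?(exprS _ n.+3) ?(exprS _ n.+2) ?(exprS _ n.+1) ?(exprS _ n); field.
Qed.

End CosineVariable.
End Derivatives.

(** * The Casimir operator in the variables x, y *)

Section ReducedOperator.
Variable R : realFieldType.

(** [A1], [A2], [A3], [A4] are the coordinates of lambda on the fundamental weights of index 1, 2,
    m, m + 1; the quadratic part is their Gram form. *)
Definition casimir_formula (m a b i d1 d2 : R) : R :=
  let A1 := a - i + d1 in let A2 := i + b + d2 in
  let A3 := d2 in let A4 := i + d1 in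
  ((m + 1) * (A1 ^+ 2 + A4 ^+ 2) + 2 * m * (A2 ^+ 2 + A3 ^+ 2)
   + 2 * m * (A1 * A2 + A3 * A4) + 2 * A1 * A4
   + 4 * (A1 * A3 + A2 * A4) + 8 * A2 * A3) / (m + 2)
  + (m + 1) * (A1 + A4) + 2 * m * (A2 + A3).

(* R(Omega) conjugated by cos^(b+l) t1 cos^(b+k) t2, where l = a - k; the values
   gu and gd stand for l times the component k + 1 and k times the component
   k - 1. *)
Definition reduced_casimir (m k l b x y g gx gy gxx gyy gu gd : R) : R :=
  let e1 := b + l in let e2 := b + k in
  (m * e1 ^+ 2 - 4 * e1 * e2 + m * e2 ^+ 2) / (2 * (m + 2)) * g
  + (e1 ^+ 2 / 2 + (m - 1) * e1 + e2 ^+ 2 / 2 + (m - 1) * e2) * g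
  + (x * (2 * e1 + 2 * m) - (2 * e1 + 2)) * gx
  + (y * (2 * e2 + 2 * m) - (2 * e2 + 2)) * gy
  - 2 * x * (1 - x) * gxx - 2 * y * (1 - y) * gyy
  + (2 * (1 - x) * (e1 * g + 2 * x * gx)
     - 2 * (1 - y) * (e2 * g + 2 * y * gy)) / (y - x)
  - 2 * (2 - x - y) / (y - x) ^+ 2 * ((k + 1) * y * gu + (l + 1) * x * gd)
  + 2 * (x + y - 2 * x * y) / (y - x) ^+ 2 * ((k + 1) * l + k * (l + 1)) * g.

(* w1, w2, u and v are w_(i-1), (k+l+2-i) w_(i-2) and the partial derivatives of
   w_(i-1). *)
Lemma reduced_casimir_base (m k l b i x y w w1 wx wy u v wxx wyy w2 wu wd : R) :
  0 < m -> x != 0 -> y != 0 -> x - y != 0 ->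
  wx = (i * w - y * (k + l + 1 - i) * w1) / (x - y) ->
  wy = (x * (k + l + 1 - i) * w1 - i * w) / (x - y) ->
  w2 = (i * w - (k * x + l * y) * w1 + (x + y) * (i - 1) * w1) / (x * y) ->
  u = ((i - 1) * w1 - y * w2) / (x - y) ->
  v = (x * w2 - (i - 1) * w1) / (x - y) ->
  wxx = ((i - 1) * wx - y * (k + l + 1 - i) * u) / (x - y) ->
  wyy = (x * (k + l + 1 - i) * v - (i - 1) * wy) / (x - y) ->
  wu = l * w + (x - y) * wy ->
  wd = k * w + (y - x) * wx ->
  reduced_casimir m k l b x y w wx wy wxx wyy wu wd =
  casimir_formula m (k + l) b i 0 0 * w
  - 2 * (k + l + 1 - i) * (b + i) * w1.
Proof.
(* Substituting the nine equations in order leaves only [w] and [w1], so the claim becomes an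
   identity of rational functions. *)
move=> m0 x0 y0 xy -> -> -> -> -> -> -> -> ->.
have yx : y - x != 0 by rewrite -opprB oppr_eq0.
have m2 : m + 2 != 0 by apply: lt0r_neq0; rewrite addr_gt0.
rewrite /reduced_casimir /casimir_formula; field.
by rewrite x0 y0 xy yx m2.
Qed.

(* f is (x + y)^d1 (xy)^d2, with logarithmic derivatives fx and fy; wn is
   (i+1) w_(i+1). *)
Lemma reduced_casimir_prod (m k l b i d1 d2 x y f w w1 wx wy wxx wyy wn wu wd : R) :
  0 < m -> x != 0 -> y != 0 -> x + y != 0 -> x - y != 0 ->
  wx = (i * w - y * (k + l + 1 - i) * w1) / (x - y) ->
  wy = (x * (k + l + 1 - i) * w1 - i * w) / (x - y) ->
  wn = (k * x + l * y) * w - (x ^+ 2 * wx + y ^+ 2 * wy) ->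
  reduced_casimir m k l b x y w wx wy wxx wyy wu wd =
    casimir_formula m (k + l) b i 0 0 * w
    - 2 * (k + l + 1 - i) * (b + i) * w1 ->
  let fx := d1 / (x + y) + d2 / x in let fy := d1 / (x + y) + d2 / y in
  let fxx := fx ^+ 2 - d1 / (x + y) ^+ 2 - d2 / x ^+ 2 in
  let fyy := fy ^+ 2 - d1 / (x + y) ^+ 2 - d2 / y ^+ 2 in
  reduced_casimir m k l b x y (f * w)
    (f * (fx * w + wx)) (f * (fy * w + wy))
    (f * (fxx * w + 2 * fx * wx + wxx)) (f * (fyy * w + 2 * fy * wy + wyy))
    (f * wu) (f * wd) =
  f * (casimir_formula m (k + l) b i d1 d2 * w
    - 2 * d1 * (k + l + 1 - i) * (x * y / (x + y)) * w1
    - 2 * d1 / (x + y) * wn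
    - 4 * d1 * (d1 - 1) * (x * y / (x + y) ^+ 2) * w
    - 2 * d2 / (x * y) * wn
    - 2 * (k + l + 1 - i) * (b + i + d2) * w1
    - 2 * d2 * (b + i + d2) * ((x + y) / (x * y)) * w
    - 2 * d1 * (d1 + 2 * i + (k + l) + 2 * b + 4 * d2 + 3) / (x + y) * w).
Proof.
move=> m0 x0 y0 s0 xy wxE wyE wnE base fx fy fxx fyy.
have yx : y - x != 0 by rewrite -opprB oppr_eq0.
have m2 : m + 2 != 0 by apply: lt0r_neq0; rewrite addr_gt0.
(* The inner difference is the commutator with [f]: by linearity [wxx], [wyy], [wu] and [wd] cancel
   in it, hence the zeros. *)
transitivity (f * (reduced_casimir m k l b x y w wx wy wxx wyy wu wd +
  (reduced_casimir m k l b x y w (fx * w + wx) (fy * w + wy)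
    (fxx * w + 2 * fx * wx) (fyy * w + 2 * fy * wy) 0 0
   - reduced_casimir m k l b x y w wx wy 0 0 0 0))).
  by rewrite /reduced_casimir; field; rewrite yx m2.
rewrite base wnE wxE wyE /fxx /fyy /fx /fy /reduced_casimir /casimir_formula.
by field; rewrite x0 y0 s0 xy yx m2.
Qed.
End ReducedOperator.

(** * Trigonometric coefficients as rational functions of x and y *)

Section Trigonometry.
Variable R : realType.
Implicit Types t : R.

(** The singularities in [t1 + t2] and [t1 - t2] thus merge into the single denominator [y - x],
    nonzero at regular points. *)
Lemma sinDB t1 t2 : sin (t1 + t2) * sin (t1 - t2) = cos t2 ^+ 2 - cos t1 ^+ 2.
Proof.
by rewrite sinB sinD; ring: (sin2cos2 t1) (sin2cos2 t2).
Qed.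

Lemma cotD t1 t2 : sin (t1 + t2) != 0 -> sin (t1 - t2) != 0 ->
  cos (t1 + t2) / sin (t1 + t2) =
  (sin t1 * cos t1 - sin t2 * cos t2) / (cos t2 ^+ 2 - cos t1 ^+ 2).
Proof.
move=> sD sB; rewrite -sinDB; apply/eqP; rewrite eqr_div ?mulf_neq0 //.
apply/eqP; rewrite mulrCA [RHS]mulrC; congr (_ * _).
by rewrite cosD sinB; ring: (sin2cos2 t1) (sin2cos2 t2).
Qed.

Lemma cotB t1 t2 : sin (t1 + t2) != 0 -> sin (t1 - t2) != 0 ->
  cos (t1 - t2) / sin (t1 - t2) =
  (sin t1 * cos t1 + sin t2 * cos t2) / (cos t2 ^+ 2 - cos t1 ^+ 2).
Proof.
move=> sD sB; have := @cotD t1 (- t2); rewrite opprK sinN cosN => -> //.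
by rewrite mulNr opprK.
Qed.

Lemma sum_cos_div_sqr_sin t1 t2 : sin (t1 + t2) != 0 -> sin (t1 - t2) != 0 ->
  cos (t1 + t2) / sin (t1 + t2) ^+ 2 + cos (t1 - t2) / sin (t1 - t2) ^+ 2 =
  2 * (cos t1 * cos t2) * (2 - cos t1 ^+ 2 - cos t2 ^+ 2)
    / (cos t2 ^+ 2 - cos t1 ^+ 2) ^+ 2.
Proof.
move=> sD sB; rewrite -sinDB exprMn addf_div ?expf_neq0 //; congr (_ / _).
by rewrite cosB sinB cosD sinD; ring: (sin2cos2 t1) (sin2cos2 t2).
Qed.

Lemma sum_inv_sqr_sin t1 t2 : sin (t1 + t2) != 0 -> sin (t1 - t2) != 0 ->
  (sin (t1 + t2) ^+ 2)^-1 + (sin (t1 - t2) ^+ 2)^-1 =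
  2 * (cos t1 ^+ 2 + cos t2 ^+ 2 - 2 * cos t1 ^+ 2 * cos t2 ^+ 2)
    / (cos t2 ^+ 2 - cos t1 ^+ 2) ^+ 2.
Proof.
move=> sD sB; rewrite -sinDB exprMn.
rewrite -[X in X + _]mul1r -[X in _ + X]mul1r addf_div ?expf_neq0 //.
congr (_ / _).
by rewrite sinB sinD; ring: (sin2cos2 t1) (sin2cos2 t2).
Qed.

Lemma cot2 t : cos (2 * t) / sin (2 * t) =
  (2 * cos t ^+ 2 - 1) / (2 * sin t * cos t).
Proof.
by rewrite mulr_natl mulr2n sinD cosD; congr (_ / _); ring: (sin2cos2 t).
Qed.

(** The values and derivatives of [G] enter as hypotheses, so only algebra modulo
    [sin^2 = 1 - cos^2] remains. [K] is the prefactor of the conjugation; a step in [k] moves one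
    power between [cos t1] and [cos t2], whence the ratios in the neighbouring components. *)
Lemma radial_casimirE (m a b : nat) (G : nat -> R -> R -> R) k t1 t2
    (K g gx gy gxx gyy gu gd : R) :
  (k <= a)%N -> regular t1 t2 ->
  let x := cos t1 ^+ 2 in let y := cos t2 ^+ 2 in
  let e1 := b%:R + (a - k)%:R in let e2 := b%:R + k%:R in
  G k t1 t2 = K * g ->
  partial1 1 (G k) t1 t2 = - (sin t1 / cos t1) * K * (e1 * g + 2 * x * gx) ->
  partial2 1 (G k) t1 t2 = - (sin t2 / cos t2) * K * (e2 * g + 2 * y * gy) ->
  partial1 2 (G k) t1 t2 = K * ((1 - x) *
    (e1 * (e1 - 1) / x * g + (4 * e1 + 2) * gx + 4 * x * gxx)
    - e1 * g - 2 * x * gx) ->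
  partial2 2 (G k) t1 t2 = K * ((1 - y) *
    (e2 * (e2 - 1) / y * g + (4 * e2 + 2) * gy + 4 * y * gyy)
    - e2 * g - 2 * y * gy) ->
  (a - k)%:R * G k.+1 t1 t2 = K * (cos t2 / cos t1) * gu ->
  k%:R * G k.-1 t1 t2 = K * (cos t1 / cos t2) * gd ->
  radial_casimir m a b G k t1 t2 =
  K * reduced_casimir m%:R k%:R (a - k)%:R b%:R x y g gx gy gxx gyy gu gd.
Proof.
move=> ka reg x y e1 e2 G0 G1 G2 G11 G22 Gu Gd.
have [_ _ sD sB] := reg; have [s1 s2 c1 c2] := regular_sin_cos reg.
have yx : cos t2 ^+ 2 - cos t1 ^+ 2 != 0 by rewrite -sinDB mulf_neq0.
rewrite /radial_casimir; cbv zeta.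
have -> : a%:R = k%:R + (a - k)%:R :> R by rewrite -natrD subnKC.
rewrite G0 G1 G2 G11 G22 cotD // cotB // sum_cos_div_sqr_sin //.
rewrite sum_inv_sqr_sin // !cot2.
have -> : (k%:R + 1) * (k%:R + (a - k)%:R - k%:R) * G k.+1 t1 t2 =
    (k%:R + 1) * (K * (cos t2 / cos t1) * gu) :> R by rewrite -Gu; ring.
have -> : k%:R * (k%:R + (a - k)%:R - k%:R + 1) * G k.-1 t1 t2 =
    ((a - k)%:R + 1) * (K * (cos t1 / cos t2) * gd) :> R by rewrite -Gd; ring.
have m2 : m%:R + 2 != 0 :> R by rewrite -natrD pnatr_eq0 addn2.
rewrite /reduced_casimir /x /y /e1 /e2.
field: (sin2cos2 t1) (sin2cos2 t2).
by rewrite s1 s2 c1 c2 yx m2.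
Qed.

End Trigonometry.

(** * The functions Q *)

Section Hypergeometric.
Variable R : realType.

Lemma pochhammer_opp (n p : nat) : (p <= n)%N ->
  pochhammer (- n%:R : R) p = (-1) ^+ p * (n ^_ p)%:R.
Proof.
elim: p => [|p IHp] pn; first by rewrite /pochhammer big_ord0 mul1r.
rewrite /pochhammer big_ord_recr /= -/(pochhammer _ _) IHp ?(ltnW pn) //.
by rewrite ffactnSr natrM natrB ?(ltnW pn) // exprS; ring.
Qed.

(** Multiplied by [(i - p)! (a - i)!], both sides equal [a!]. *)
Lemma bin_mul_ffact (a i p : nat) : (p <= i <= a)%N ->
  ('C(a, i) * i ^_ p = a ^_ p * 'C(a - p, i - p))%N.
Proof.
case/andP => pi ia; apply/eqP.
rewrite -(eqn_pmul2r (fact_gt0 (i - p))) -(eqn_pmul2r (fact_gt0 (a - i))).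
rewrite -(mulnA 'C(a, i)) ffact_fact // -mulnA bin_fact //.
have -> : (a - i = a - p - (i - p))%N by lia.
by rewrite -!(mulnA (a ^_ p)) -mulnA bin_fact ?ffact_fact //; lia.
Qed.

(** The first factor is expanded around [1 + y X] with increment [(x - y) X], which reproduces the
    sum over [p] in [q_fun]. *)
Lemma elem_expand (k l i : nat) (x y : R) : elem 0 k l i x y =
  \sum_(p < (minn i k).+1) 'C(k, p)%:R * 'C(k + l - p, i - p)%:R
    * (x - y) ^+ p * y ^+ (i - p).
Proof.
have coef_pow n j : ((1 + y%:P * 'X) ^+ n)`_j = 'C(n, j)%:R * y ^+ j.
  rewrite exprDn coef_sum.
  under eq_bigr do
    rewrite coefMn expr1n mul1r exprMn -polyC_exp coefCM coefXn.
  have [nj|jn] := ltnP n j.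
    rewrite bin_small // mul0r big1 // => p _.
    have := ltn_ord p; rewrite ltnS => pn.
    by rewrite gtn_eqF ?(leq_ltn_trans pn) // mulr0 mul0rn.
  rewrite (bigD1 (Ordinal (jn : (j < n.+1)%N))) //= big1 => [|p pj].
    by rewrite eqxx mulr1 addr0 mulr_natl.
  by rewrite eq_sym (negbTE (pj : val p != j)) mulr0 mul0rn.
(* The range is widened to [p <= k] with zeros for [i < p], where [X^p] contributes nothing to the
   coefficient of index [i]. *)
rewrite (big_ord_widen k.+1 (fun p => 'C(k, p)%:R * 'C(k + l - p, i - p)%:R
    * (x - y) ^+ p * y ^+ (i - p))) ?ltnS ?geq_minr // big_mkcond /=.
have -> : elem 0 k l i x y =
    (\sum_(p < k.+1) ('C(k, p)%:R * (x - y) ^+ p)%:P *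
       ('X^p * (1 + y%:P * 'X) ^+ (k + l - p)))`_i.
  rewrite /elem expr0 mul1r /genpoly.
  have -> : 1 + x%:P * 'X = (1 + y%:P * 'X) + (x - y)%:P * 'X :> {poly R}.
    by rewrite polyCB; ring.
  rewrite exprDn big_distrl /=; congr ((polyseq _)`_i).
  apply: eq_bigr => p _; have := ltn_ord p; rewrite ltnS => pk.
  rewrite exprMn -mulr_natl polyCM polyC_natr polyC_exp.
  have -> : (k + l - p = k - p + l)%N by lia.
  by rewrite exprD; ring.
rewrite coef_sum; apply: eq_bigr => p _; have := ltn_ord p; rewrite ltnS => pk.
rewrite coefCM coefXnM ltnS leq_min pk andbT.
case: leqP => ip; last by rewrite mulr0.
by rewrite coef_pow; ring.
Qed.

(** The sums agree term by term with [elem_expand]; the factor [C(a, i)] clears the denominator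
    [(-a)_p]. *)
Lemma q_fun_elem (a b i k : nat) (t1 t2 : R) : (i <= a)%N -> (k <= a)%N ->
  'C(a, i)%:R * q_fun a b i k t1 t2 =
  cos t1 ^+ (b + (a - k)) * cos t2 ^+ (b + k) *
    elem 0 k (a - k) i (cos t1 ^+ 2) (cos t2 ^+ 2).
Proof.
move=> ia ka; rewrite /q_fun elem_expand mulrCA.
have -> : (a + b - k = b + (a - k))%N by lia.
rewrite -mulrA; congr (_ * _); rewrite !mulr_sumr; apply: eq_bigr => p _.
have := ltn_ord p; rewrite ltnS leq_min => /andP[pi pk].
have pa := leq_trans pi ia.
rewrite (pochhammer_opp pi) (pochhammer_opp pk) (pochhammer_opp pa) subnKC //.
have -> : (b + 2 * i + k - 2 * p = b + k + 2 * (i - p))%N by lia.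
rewrite exprD exprM.
have cE : 'C(a, i)%:R * (i ^_ p)%:R = (a ^_ p)%:R * 'C(a - p, i - p)%:R :> R.
  by rewrite -!natrM bin_mul_ffact ?pi.
have kE : (k ^_ p)%:R = 'C(k, p)%:R * p`!%:R :> R by rewrite -natrM bin_ffact.
have a0 : (a ^_ p)%:R != 0 :> R.
  by rewrite pnatr_eq0 -lt0n ffact_gt0.
have f0 : p`!%:R != 0 :> R by rewrite pnatr_eq0 -lt0n fact_gt0.
have s0 : (-1) ^+ p != 0 :> R by rewrite signr_eq0.
(* This sign cancels the one left by the three Pochhammer symbols. *)
have -> : (cos t2 ^+ 2 - cos t1 ^+ 2) ^+ p =
    (-1) ^+ p * (cos t1 ^+ 2 - cos t2 ^+ 2) ^+ p.
  by rewrite -exprMn; congr (_ ^+ _); ring.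
have s2 : (-1) ^+ p * (-1) ^+ p = 1 :> R by rewrite -expr2 sqrr_sign.
rewrite kE; apply: (@mulfI _ (a ^_ p)%:R) => //.
set A := (a ^_ p)%:R in cE a0 *; set I := (i ^_ p)%:R in cE *.
set Cai := 'C(a, i)%:R in cE *; set Cs := 'C(a - p, i - p)%:R in cE *.
set s := (-1) ^+ p in s0 s2 *.
transitivity ((s * s) * 'C(k, p)%:R * (Cai * I)
  * (cos t1 ^+ 2 - cos t2 ^+ 2) ^+ p
  * cos t2 ^+ (b + k) * (cos t2 ^+ 2) ^+ (i - p)).
  by field; rewrite a0 f0 s0.
by rewrite s2 cE; ring.
Qed.

End Hypergeometric.

(** * The reduced operator on the coefficients w_i *)

Section ElementaryReduced.
Variable R : realType.

Lemma solve_linear2 (x y p q A B : R) : x - y != 0 ->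
  x * p + y * q = A -> p + q = B ->
  p = (A - y * B) / (x - y) /\ q = (x * B - A) / (x - y).
Proof. by move=> xy <- <-; split; field. Qed.

(** The Euler and translation identities are a linear system of determinant [x - y] for the two
    partial derivatives. *)
Lemma elem_partials s (k l i : nat) (x y : R) : x - y != 0 ->
  k%:R * elem s.+1 k.-1 l i x y =
    ((i%:R - s%:R) * elem s k l i x y -
     y * (k%:R + l%:R + 1 - (i%:R - s%:R)) * elem s.+1 k l i x y) / (x - y) /\
  l%:R * elem s.+1 k l.-1 i x y =
    (x * (k%:R + l%:R + 1 - (i%:R - s%:R)) * elem s.+1 k l i x y -
     (i%:R - s%:R) * elem s k l i x y) / (x - y).
Proof.
move=> xy; have [-> ->] := solve_linear2 xy (elem_Euler s k l i x y)
  (elem_translate s k l i x y).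
by split; congr (_ / _); ring.
Qed.

Lemma reduced_casimir_elem (m k l i : nat) (b x y : R) : (0 < m)%N ->
  x != 0 -> y != 0 -> x - y != 0 ->
  reduced_casimir m%:R k%:R l%:R b x y (elem 0 k l i x y)
    (k%:R * elem 1 k.-1 l i x y) (l%:R * elem 1 k l.-1 i x y)
    (k%:R * (k.-1%:R * elem 2 k.-2 l i x y))
    (l%:R * (l.-1%:R * elem 2 k l.-2 i x y))
    (l%:R * elem 0 k.+1 l.-1 i x y) (k%:R * elem 0 k.-1 l.+1 i x y) =
  casimir_formula m%:R (k%:R + l%:R) b i%:R 0 0 * elem 0 k l i x y
  - 2 * (k%:R + l%:R + 1 - i%:R) * (b + i%:R) * elem 1 k l i x y.
Proof.
move=> m0 x0 y0 xy.
have [ex ey] := elem_partials 0 k l i xy.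
have [eu ev] := elem_partials 1 k l i xy.
have [exx _] := elem_partials 1 k.-1 l i xy.
have [_ eyy] := elem_partials 1 k l.-1 i xy.
(* The factor [k + l + 2 - i] is that of [elem_translate] at [s = 1]; lowering [k] or [l] by one for
   the second derivatives turns it into [k + l + 1 - i]. *)
apply: (@reduced_casimir_base _ _ _ _ _ _ _ _ _ (elem 1 k l i x y) _ _
  (k%:R * elem 2 k.-1 l i x y) (l%:R * elem 2 k l.-1 i x y) _ _
  ((k%:R + l%:R + 2 - i%:R) * elem 2 k l i x y)) => //.
- by rewrite ltr0n.
- by rewrite ex subr0.
- by rewrite ey subr0.
(* Eliminating [u] and [v] gives [i w = (k x + l y) w1 - (x + y) (i - 1) w1 + x y w2], to be solved
   for [w2]. *)
- have := elem_recurrence 0 k l i x y; rewrite subr0 => ->.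
  by rewrite eu ev; field; rewrite x0 y0 xy.
- by rewrite eu; congr (_ / _); ring.
- by rewrite ev; congr (_ / _); ring.
- rewrite exx; case: k {ex ey eu ev exx eyy} => [|k]; first by rewrite !mul0r; ring.
  by rewrite /= -natr1; field.
- rewrite eyy; case: l {ex ey eu ev exx eyy} => [|l]; first by rewrite !mul0r; ring.
  by rewrite /= -natr1; field.
- exact: elem_shift_left.
- exact: elem_shift_right.
Qed.

End ElementaryReduced.

(** * Derivatives of the components and the seven-term formula *)

Section Components.
Variable R : realType.
Implicit Types (d k l i : nat) (x y : R).

Definition symm d1 d2 x y : R := (x + y) ^+ d1 * (x * y) ^+ d2.

(** Only derivatives in the first variable are formed; [symmC] and [elemC] give the others. This
    polynomial form, unlike the logarithmic one of [dsymmE], also makes sense where a denominator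
    vanishes. *)
Definition dsymm d1 d2 x y : R :=
  d1%:R * symm d1.-1 d2 x y + d2%:R * (y * symm d1 d2.-1 x y).

Definition ddsymm d1 d2 x y : R :=
  d1%:R * dsymm d1.-1 d2 x y + d2%:R * (y * dsymm d1 d2.-1 x y).

Lemma symmC d1 d2 x y : symm d1 d2 x y = symm d1 d2 y x.
Proof. by rewrite /symm addrC (mulrC x). Qed.

Lemma is_derive_symm d1 d2 x y :
  is_derive x 1 (fun z => symm d1 d2 z y) (dsymm d1 d2 x y).
Proof.
have dD : is_derive x 1 (fun z => z + y) 1.
  have d := is_deriveD (is_derive_id x 1) (is_derive_cst y x 1).
  by apply: (is_derive_eq d); rewrite addr0.
have dM : is_derive x 1 (fun z => z * y) y.
  have d := is_deriveM (is_derive_id x 1) (is_derive_cst y x 1).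
  by apply: (is_derive_eq d); rewrite /GRing.scale /= mulr0 add0r mulr1.
have d := is_deriveM
  (@is_derive1_comp _ (fun z => z ^+ d1) (fun z => z + y) _ _ _
    (is_derive_pow d1 (x + y)) dD)
  (@is_derive1_comp _ (fun z => z ^+ d2) (fun z => z * y) _ _ _
    (is_derive_pow d2 (x * y)) dM).
by apply: (is_derive_eq d); rewrite /dsymm /symm /GRing.scale /=; ring.
Qed.

Lemma is_derive_dsymm d1 d2 x y :
  is_derive x 1 (fun z => dsymm d1 d2 z y) (ddsymm d1 d2 x y).
Proof.
have d := is_deriveD
  (is_deriveZ d1%:R (is_derive_symm d1.-1 d2 x y))
  (is_deriveZ d2%:R (is_deriveZ y (is_derive_symm d1 d2.-1 x y))).
exact: (is_derive_eq d).
Qed.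

Lemma dsymmE d1 d2 x y : x != 0 -> y != 0 -> x + y != 0 ->
  dsymm d1 d2 x y =
  symm d1 d2 x y * (d1%:R / (x + y) + d2%:R / x).
Proof.
move=> x0 y0 s0; rewrite /dsymm /symm.
case: d1 d2 => [|d1] [|d2] /=; rewrite ?(exprS _ d1) ?(exprS _ d2);
by field; rewrite ?x0 ?y0 ?s0.
Qed.

Lemma ddsymmE d1 d2 x y : x != 0 -> y != 0 -> x + y != 0 ->
  ddsymm d1 d2 x y =
  symm d1 d2 x y * ((d1%:R / (x + y) + d2%:R / x) ^+ 2
    - d1%:R / (x + y) ^+ 2 - d2%:R / x ^+ 2).
Proof.
move=> x0 y0 s0; rewrite /ddsymm !dsymmE // /symm.
case: d1 d2 => [|d1] [|d2] /=; rewrite ?(exprS _ d1) ?(exprS _ d2);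
by field; rewrite ?x0 ?y0 ?s0.
Qed.

Definition dprod d1 d2 k l i x y : R :=
  dsymm d1 d2 x y * elem 0 k l i x y +
  symm d1 d2 x y * (k%:R * elem 1 k.-1 l i x y).

Definition ddprod d1 d2 k l i x y : R :=
  ddsymm d1 d2 x y * elem 0 k l i x y +
  2 * (dsymm d1 d2 x y * (k%:R * elem 1 k.-1 l i x y)) +
  symm d1 d2 x y * (k%:R * (k.-1%:R * elem 2 k.-2 l i x y)).

Lemma is_derive_prod (C : R) d1 d2 k l i x y :
  is_derive x 1 (fun z => C * (symm d1 d2 z y * elem 0 k l i z y))
    (C * dprod d1 d2 k l i x y).
Proof.
have d := is_deriveZ C
  (is_deriveM (is_derive_symm d1 d2 x y) (is_derive_elem 0 k l i x y)).
apply: (is_derive_eq d); rewrite /dprod /GRing.scale /=; ring.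
Qed.

Lemma is_derive_dprod (C : R) d1 d2 k l i x y :
  is_derive x 1 (fun z => C * dprod d1 d2 k l i z y)
    (C * ddprod d1 d2 k l i x y).
Proof.
have d := is_deriveZ C (is_deriveD
  (is_deriveM (is_derive_dsymm d1 d2 x y) (is_derive_elem 0 k l i x y))
  (is_deriveM (is_derive_symm d1 d2 x y)
    (is_deriveZ k%:R (is_derive_elem 1 k.-1 l i x y)))).
apply: (is_derive_eq d); rewrite /ddprod /GRing.scale /= /GRing.scale /=; ring.
Qed.

Lemma dprodE d1 d2 k l i x y : x != 0 -> y != 0 -> x + y != 0 ->
  dprod d1 d2 k l i x y = symm d1 d2 x y *
    ((d1%:R / (x + y) + d2%:R / x) * elem 0 k l i x y +
     k%:R * elem 1 k.-1 l i x y).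
Proof. by move=> x0 y0 s0; rewrite /dprod dsymmE //; ring. Qed.

Lemma ddprodE d1 d2 k l i x y : x != 0 -> y != 0 -> x + y != 0 ->
  ddprod d1 d2 k l i x y = symm d1 d2 x y *
    (((d1%:R / (x + y) + d2%:R / x) ^+ 2 - d1%:R / (x + y) ^+ 2
       - d2%:R / x ^+ 2) * elem 0 k l i x y +
     2 * (d1%:R / (x + y) + d2%:R / x) * (k%:R * elem 1 k.-1 l i x y) +
     k%:R * (k.-1%:R * elem 2 k.-2 l i x y)).
Proof. by move=> x0 y0 s0; rewrite /ddprod dsymmE // ddsymmE //; ring. Qed.

Variables (m a b : nat).

(** With [s = 0] and [N = 1 / C(a, i)] this is a component of Q; [s = 1] encodes the index [i - 1].
    Keeping [N] free lets [i] move without changing the normalisation. *)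
Definition qcomp (N : R) d1 d2 s i k (t1 t2 : R) : R :=
  N * (cos t1 ^+ (b + (a - k)) * cos t2 ^+ (b + k) *
    (symm d1 d2 (cos t1 ^+ 2) (cos t2 ^+ 2) *
     elem s k (a - k) i (cos t1 ^+ 2) (cos t2 ^+ 2))).

(** Each lowered exponent of [symm] stands behind a factor that vanishes when the predecessor is
    truncated. *)
Lemma radial_casimir_qcomp (N : R) d1 d2 i k (t1 t2 : R) :
  (0 < m)%N -> (k <= a)%N -> regular t1 t2 ->
  radial_casimir m a b (qcomp N d1 d2 0 i) k t1 t2 =
  casimir_formula m%:R a%:R b%:R i%:R d1%:R d2%:R * qcomp N d1 d2 0 i k t1 t2
  + (- 2 * (a%:R + 1 - i%:R) * (d1%:R * qcomp N d1.-1 d2.+1 1 i k t1 t2)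
     + (- 2 * i.+1%:R * (d1%:R * qcomp N d1.-1 d2 0 i.+1 k t1 t2)
     + (- 4 * (d1%:R * (d1.-1%:R * qcomp N d1.-2 d2.+1 0 i k t1 t2))
     + (- 2 * i.+1%:R * (d2%:R * qcomp N d1 d2.-1 0 i.+1 k t1 t2)
     + (- 2 * (a%:R + 1 - i%:R) * (b%:R + i%:R + d2%:R)
         * qcomp N d1 d2 1 i k t1 t2
     + (- 2 * (b%:R + i%:R + d2%:R)
         * (d2%:R * qcomp N d1.+1 d2.-1 0 i k t1 t2)
     + - 2 * (d1%:R + 2 * i%:R + a%:R + 2 * b%:R + 4 * d2%:R + 3)
         * (d1%:R * qcomp N d1.-1 d2 0 i k t1 t2))))))).
Proof.
move=> m0 ka reg.
pose x := cos t1 ^+ 2; pose y := cos t2 ^+ 2.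
pose w := elem 0 k (a - k) i x y; pose w1 := elem 1 k (a - k) i x y.
pose wn := i.+1%:R * elem 0 k (a - k) i.+1 x y.
have [_ _ sD sB] := reg; have [s1 s2 c1 c2] := regular_sin_cos reg.
have x0 : x != 0 by rewrite /x expf_neq0.
have y0 : y != 0 by rewrite /y expf_neq0.
have xD : x + y != 0.
  by rewrite paddr_eq0 ?sqr_ge0 // negb_and x0.
have yx : y - x != 0 by rewrite -sinDB mulf_neq0.
have xy : x - y != 0 by rewrite -opprB oppr_eq0.
pose l := (a - k)%N; have aE : a%:R = k%:R + l%:R :> R by rewrite -natrD subnKC.
pose K := N * (cos t1 ^+ (b + l) * cos t2 ^+ (b + k)).
have G1E : (fun s => qcomp N d1 d2 0 i k s t2) = (fun s => cos s ^+ (b + l) *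
    (N * cos t2 ^+ (b + k) * (symm d1 d2 (cos s ^+ 2) y *
      elem 0 k l i (cos s ^+ 2) y))).
  by apply/funext => s; rewrite /qcomp; ring.
(* Exchanging [x] with [y] and [k] with [l] makes the lemmas for the first variable apply to the
   second. *)
have G2E : (fun s => qcomp N d1 d2 0 i k t1 s) = (fun s => cos s ^+ (b + k) *
    (N * cos t1 ^+ (b + l) * (symm d1 d2 (cos s ^+ 2) x *
      elem 0 l k i (cos s ^+ 2) x))).
  by apply/funext => s; rewrite /qcomp symmC elemC; ring.
have F1 := is_derive_prod (N * cos t2 ^+ (b + k)) d1 d2 k l i ^~ y.
have dF1 := is_derive_dprod (N * cos t2 ^+ (b + k)) d1 d2 k l i ^~ y.
have F2 := is_derive_prod (N * cos t1 ^+ (b + l)) d1 d2 l k i ^~ x.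
have dF2 := is_derive_dprod (N * cos t1 ^+ (b + l)) d1 d2 l k i ^~ x.
have H0 : qcomp N d1 d2 0 i k t1 t2 = K * (symm d1 d2 x y * w).
  by rewrite /qcomp /K /w; ring.
have H1 : partial1 1 (qcomp N d1 d2 0 i k) t1 t2 = - (sin t1 / cos t1) * K *
    ((b%:R + l%:R) * (symm d1 d2 x y * w) + 2 * x * dprod d1 d2 k l i x y).
  rewrite /partial1 G1E (derive1n1_cos_pow _ F1 c1) natrD -/x /K /w -/l; ring.
have H2 : partial2 1 (qcomp N d1 d2 0 i k) t1 t2 = - (sin t2 / cos t2) * K *
    ((b%:R + k%:R) * (symm d1 d2 x y * w) + 2 * y * dprod d1 d2 l k i y x).
  rewrite /partial2 G2E (derive1n1_cos_pow _ F2 c2) natrD -/y /K /w -/l.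
  rewrite (elemC _ l) (symmC _ _ y); ring.
have H11 := derive1n2_cos_pow (b + l) F1 dF1 c1.
have H22 := derive1n2_cos_pow (b + k) F2 dF2 c2.
have {}H11 : partial1 2 (qcomp N d1 d2 0 i k) t1 t2 = K * ((1 - x) *
    ((b%:R + l%:R) * ((b%:R + l%:R) - 1) / x * (symm d1 d2 x y * w)
     + (4 * (b%:R + l%:R) + 2) * dprod d1 d2 k l i x y
     + 4 * x * ddprod d1 d2 k l i x y)
    - (b%:R + l%:R) * (symm d1 d2 x y * w) - 2 * x * dprod d1 d2 k l i x y).
  by rewrite /partial1 G1E H11 natrD -/x /K /w -/l; ring.
have {}H22 : partial2 2 (qcomp N d1 d2 0 i k) t1 t2 = K * ((1 - y) *
    ((b%:R + k%:R) * ((b%:R + k%:R) - 1) / y * (symm d1 d2 x y * w)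
     + (4 * (b%:R + k%:R) + 2) * dprod d1 d2 l k i y x
     + 4 * y * ddprod d1 d2 l k i y x)
    - (b%:R + k%:R) * (symm d1 d2 x y * w) - 2 * y * dprod d1 d2 l k i y x).
  rewrite /partial2 G2E H22 natrD -/y /K /w -/l.
  by rewrite (elemC _ l) (symmC _ _ y); ring.
(* At [k = a] the truncated difference [a - k.+1] is neutralised by the factor [l = 0]. *)
have Hu : l%:R * qcomp N d1 d2 0 i k.+1 t1 t2 = K * (cos t2 / cos t1) *
    (symm d1 d2 x y * (l%:R * elem 0 k.+1 l.-1 i x y)).
  rewrite /qcomp /K subnS -/l -/x -/y.
  case: (l) => [|l']; first by ring.
  by rewrite !addnS /= !(exprS _ (b + _)); field.
have Hd : k%:R * qcomp N d1 d2 0 i k.-1 t1 t2 = K * (cos t1 / cos t2) *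
    (symm d1 d2 x y * (k%:R * elem 0 k.-1 l.+1 i x y)).
  rewrite /qcomp /K -/l -/x -/y.
  case: k ka @l {aE K G1E G2E F1 dF1 F2 dF2 H0 H1 H2 H11 H22 Hu w w1 wn}
    => [|k'] k'a; first by ring.
  have -> : (a - k'.+1.-1 = (a - k'.+1).+1)%N by rewrite /=; lia.
  by rewrite !addnS /= !(exprS _ (b + _)); field.
rewrite (@radial_casimirE _ m a b _ k t1 t2 _ _ _ _ _ _ _ _ ka reg
  H0 H1 H2 H11 H22 Hu Hd) -/x -/y -/l.
(* The middle expression is that of [reduced_casimir_prod]; its quotients by [x + y] and [x y] are
   absorbed into shifted exponents of [symm], case by case in [d1] and [d2]. *)
transitivity (K * (symm d1 d2 x y *
   (casimir_formula m%:R (k%:R + l%:R) b%:R i%:R d1%:R d2%:R * w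
    - 2 * d1%:R * (k%:R + l%:R + 1 - i%:R) * (x * y / (x + y)) * w1
    - 2 * d1%:R / (x + y) * wn
    - 4 * d1%:R * (d1%:R - 1) * (x * y / (x + y) ^+ 2) * w
    - 2 * d2%:R / (x * y) * wn
    - 2 * (k%:R + l%:R + 1 - i%:R) * (b%:R + i%:R + d2%:R) * w1
    - 2 * d2%:R * (b%:R + i%:R + d2%:R) * ((x + y) / (x * y)) * w
    - 2 * d1%:R * (d1%:R + 2 * i%:R + (k%:R + l%:R) + 2 * b%:R + 4 * d2%:R + 3)
        / (x + y) * w))); last first.
  rewrite aE /qcomp -/x -/y -/l -/w -/w1.
  have -> : elem 0 k l i.+1 x y = wn / i.+1%:R.
    by rewrite /wn -/l [RHS]mulrC mulKf // pnatr_eq0.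
  rewrite /K /symm; case: d1 d2 {G1E G2E F1 dF1 F2 dF2 H0 H1 H2 H11 H22 Hu Hd}
    => [|[|d1']] [|d2'] /=;
  rewrite ?(exprS _ d1'.+2) ?(exprS _ d1'.+1) ?(exprS _ d1') ?(exprS _ d2'.+1)
    ?(exprS _ d2');
  by field; rewrite x0 y0 xD nat1r pnatr_eq0.
congr (_ * _).
have yD : y + x != 0 by rewrite addrC.
rewrite dprodE // ddprodE // (dprodE _ _ _ _ _ y0 x0 yD).
rewrite (ddprodE _ _ _ _ _ y0 x0 yD) (symmC _ _ y) !(elemC _ _ _ _ y).
rewrite (addrC y x).
have := elem_partials 0 k l i xy; rewrite subr0 => -[ex ey].
apply: (@reduced_casimir_prod _ m%:R k%:R l%:R b%:R i%:R d1%:R d2%:R x y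
  (symm d1 d2 x y) w w1) => //.
- by rewrite ltr0n.
- have := elem_recurrence 0 k l i.+1 x y.
  by rewrite !elemS subr0.
- exact: reduced_casimir_elem.
Qed.

End Components.

(** * Weights *)

Section WeightComputations.
Variables (R : realType) (m : nat).

(** [preceq l' l] unfolds to the membership of [l - l'] in this cone. *)
Definition root_cone : set 'rV[R]_m.+2 :=
  [set v | exists n : nat -> nat, v = \sum_(1 <= i < m.+2) alpha R m i *+ n i].

Lemma root_coneD u v : root_cone u -> root_cone v -> root_cone (u + v).
Proof.
move=> [n ->] [p ->]; exists (fun i => n i + p i)%N.
by rewrite -big_split /=; apply: eq_bigr => i _; rewrite mulrnDr.
Qed.

Lemma root_cone_alpha i : (0 < i < m.+2)%N -> root_cone (alpha R m i).
Proof.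
move=> im; exists (fun j => (j == i) : nat).
rewrite (bigD1_seq i) ?mem_index_iota ?iota_uniq //=.
by rewrite eqxx mulr1n big1 ?addr0 // => j /negbTE ->; rewrite mulr0n.
Qed.

(** The difference telescopes into [alpha_i + ... + alpha_(j-1)]. *)
Lemma root_cone_eps i j : (0 < i < j)%N -> (j <= m.+2)%N ->
  root_cone (eps R m i - eps R m j).
Proof.
move=> /andP[i0]; elim: j => // j IHj.
rewrite ltnS leq_eqVlt => /orP[/eqP <- jm|ij jm].
  by apply: root_cone_alpha; rewrite i0.
have -> : eps R m i - eps R m j.+1 = (eps R m i - eps R m j) + alpha R m j.
  by rewrite /alpha addrA subrK.
apply: root_coneD; first by apply: IHj => //; exact: ltnW.
by apply: root_cone_alpha; rewrite (leq_trans _ ij).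
Qed.

Lemma lambda1_eps : lambda1 R m = eps R m 1 - eps R m m.+2.
Proof.
apply/rowP => c; rewrite !mxE !eqSS.
have -> : (c == m.+1 :> nat) = ~~ (c < m.+1)%N by have := ltn_ord c; lia.
have -> : (c == 0 :> nat) = (c < 1)%N by lia.
have m0 : m%:R + 1 + 1 != 0 :> R by rewrite !natr1 pnatr_eq0.
by case: (c < m.+1)%N => /=; rewrite -!natr1; field.
Qed.

Lemma lambda2_eps : (0 < m)%N ->
  lambda2 R m = eps R m 1 + eps R m 2 - eps R m m.+1 - eps R m m.+2.
Proof.
move=> m0; apply/rowP => c; rewrite !mxE !eqSS.
have cm := ltn_ord c.
have -> : (c < 2)%N%:R = (c == 0 :> nat)%:R + (c == 1 :> nat)%:R :> R.
  by rewrite -natrD; congr (_%:R); lia.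
have -> : (c < m)%N%:R = 1 - (c == m :> nat)%:R - (c == m.+1 :> nat)%:R :> R.
  rewrite -addrA -opprD -natrD -[1]/(1%:R) -natrB; last by lia.
  by congr (_%:R); lia.
have n0 : m%:R + 1 + 1 != 0 :> R by rewrite !natr1 pnatr_eq0.
by rewrite -!natr1; field.
Qed.

Lemma omega0 : omega R m 0 = 0.
Proof. by apply/rowP => c; rewrite !mxE ltn0 mul0r subr0. Qed.

Lemma weight_ofE a b i d1 d2 : (i <= a)%N ->
  weight_of R m a b (i, d1, d2) =
  (a%:R - i%:R + d1%:R) *: omega R m 1 + (i%:R + b%:R + d2%:R) *: omega R m 2
  + d2%:R *: omega R m m + (i%:R + d1%:R) *: omega R m m.+1.
Proof.
move=> ia; rewrite /weight_of /nu /lambda1 /lambda2 /=.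
have sn (v : 'rV[R]_m.+2) n : v *+ n = n%:R *: v by rewrite scaler_nat.
rewrite !sn natrB // natrD.
move: (omega R m 1) (omega R m 2) (omega R m m) (omega R m m.+1).
by move=> o1 o2 o3 o4; apply/rowP => c; rewrite !mxE; ring.
Qed.

Lemma weight_of_sub a b i d1 d2 i' d1' d2' : (0 < m)%N ->
  (i <= a)%N -> (i' <= a)%N ->
  weight_of R m a b (i, d1, d2) - weight_of R m a b (i', d1', d2') =
  (i%:R - i'%:R) *: (eps R m 2 - eps R m m.+2)
  + (d1%:R - d1'%:R) *: (eps R m 1 - eps R m m.+2)
  + (d2%:R - d2'%:R) *: (eps R m 1 + eps R m 2 - eps R m m.+1 - eps R m m.+2).
Proof.
move=> m0 ia i'a; rewrite -lambda2_eps // -lambda1_eps !weight_ofE //.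
(* Raising [i] by one adds [omega_2 + omega_(m+1) - omega_1], which is this vector. *)
have -> : eps R m 2 - eps R m m.+2 = lambda1 R m - alpha R m 1.
  rewrite lambda1_eps /alpha; move: (eps _ _ _) (eps _ _ _) (eps _ _ _).
  by move=> u v w; apply/rowP => c; rewrite !mxE; ring.
rewrite alphaE // omega0 /lambda1 /lambda2.
move: (omega R m 1) (omega R m 2) (omega R m m) (omega R m m.+1).
by move=> o1 o2 o3 o4; apply/rowP => c; rewrite !mxE; ring.
Qed.

Lemma sum_ord_lt i : (i <= m.+2)%N ->
  \sum_(c < m.+2) (c < i)%N%:R = i%:R :> R.
Proof.
move=> im; rewrite -natr_sum -big_mkcond /=.
by rewrite -(big_ord_widen m.+2 (fun _ => 1%N)) // sum1_card card_ord.
Qed.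

Lemma dot_omega i j : (i <= j <= m.+2)%N ->
  dot (omega R m i) (omega R m j) = i%:R - i%:R * j%:R / m.+2%:R.
Proof.
case/andP => ij jm; rewrite /dot mxE.
pose n : R := m.+2%:R; have n0 : n != 0 by rewrite pnatr_eq0.
(* For [i <= j] the product of the two indicators is the indicator of [c < i]. *)
transitivity (\sum_(c < m.+2) ((c < i)%N%:R - j%:R / n * (c < i)%N%:R
    - i%:R / n * (c < j)%N%:R + i%:R * j%:R / n ^+ 2) : R).
  apply: eq_bigr => c _; rewrite !mxE -/n.
  have [ci|ci] := ltnP c i; have [cj|cj] := ltnP c j => /=; try by field.
  by lia.
rewrite !big_split /= !sumrN -!mulr_sumr !sum_ord_lt ?(leq_trans ij) //.
rewrite sumr_const card_ord -mulr_natr -/n.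
by field.
Qed.

Lemma sum_nat_eq (lo hi s : nat) :
  \sum_(lo <= j < hi) (s == j)%:R = (lo <= s < hi)%N%:R :> R.
Proof.
have [les|gts] := boolP (lo <= s < hi)%N.
  rewrite (bigD1_seq s) ?mem_index_iota ?iota_uniq //= eqxx big1 ?addr0 //.
  by move=> j js; rewrite eq_sym (negbTE js).
rewrite big_nat big1 // => j jlh; case: eqVneq => // sj.
by rewrite sj jlh in gts.
Qed.

Lemma rhoE : rho R m = \row_(c < m.+2) (2^-1 * (m%:R + 1 - 2 * c%:R)).
Proof.
apply/rowP => c; rewrite !mxE; congr (_ * _); rewrite summxE.
have cm := ltn_ord c.
(* Column [c] has sign plus in [m + 1 - c] positive roots and sign minus in [c] of them. *)
transitivity (\sum_(1 <= i < m.+3)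
    ((c.+1 == i)%:R * (m.+2%:R - c.+1%:R) - (i < c.+1)%N%:R) : R).
  apply: eq_big_nat => i /andP[i0 im]; rewrite summxE.
  under eq_bigr do rewrite !mxE.
  rewrite big_split /= sumrN sum_nat_eq; congr (_ - _); last first.
    by rewrite (_ : c.+1 < m.+3)%N ?andbT.
  rewrite big_const_nat iter_addr_0.
  case: eqVneq => [<-|_]; last by rewrite mul0rn mul0r.
  by rewrite mul1r subSS natrB.
rewrite big_split /= -mulr_suml sum_nat_eq (_ : 0 < c.+1 < m.+3)%N // mul1r sumrN.
have -> : \sum_(1 <= i < m.+3) (i < c.+1)%N%:R = c%:R :> R.
  rewrite big_add1 /= big_mkord; under eq_bigr do rewrite ltnS.
  by rewrite sum_ord_lt // ltnW.
by rewrite -!natr1; ring.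
Qed.

Lemma dot_omega_rho i : (i <= m.+2)%N ->
  dot (omega R m i) (rho R m) = i%:R * (m%:R + 2 - i%:R) / 2.
Proof.
move=> im; rewrite rhoE /dot mxE.
have S j : (j <= m.+2)%N -> \sum_(c < m.+2)
    (c < j)%N%:R * (m%:R + 1 - 2 * c%:R) = j%:R * (m%:R + 2 - j%:R) :> R.
  elim: j => [|j IHj] jm.
    by rewrite mul0r big1 // => c _; rewrite mul0r.
  transitivity (\sum_(c < m.+2) ((c < j)%N%:R * (m%:R + 1 - 2 * c%:R) +
      (c == Ordinal jm)%:R * (m%:R + 1 - 2 * j%:R)) : R).
    apply: eq_bigr => c _; rewrite -val_eqE /= ltnS leq_eqVlt.
    by case: ltngtP => [?|?|->] /=; ring.
  rewrite big_split /= IHj ?(ltnW jm) // (bigD1 (Ordinal jm)) //= eqxx.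
  rewrite big1 => [|c /negbTE ->]; last by rewrite mul0r.
  by rewrite /= -(natr1 j); ring.
(* The second sum is the trace of [2 rho], which vanishes by [S] at [j = m + 2]. *)
transitivity (2^-1 * (\sum_(c < m.+2) (c < i)%N%:R * (m%:R + 1 - 2 * c%:R)
    - i%:R / m.+2%:R * \sum_(c < m.+2) (c < m.+2)%N%:R * (m%:R + 1 - 2 * c%:R)) : R).
  rewrite mulr_sumr -sumrB mulr_sumr; apply: eq_bigr => c _.
  by rewrite !mxE ltn_ord /=; ring.
have m0 : m%:R + 2 != 0 :> R by rewrite -natrD pnatr_eq0 addn2.
have mE : m.+2%:R = m%:R + 2 :> R by rewrite -natrD addn2.
by rewrite !S // mE; field.
Qed.

Lemma casimir_eigenvalueE a b i d1 d2 : (2 < m)%N -> (i <= a)%N ->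
  casimir_eigenvalue (weight_of R m a b (i, d1, d2)) =
  casimir_formula m%:R a%:R b%:R i%:R d1%:R d2%:R.
Proof.
move=> m2 ia; rewrite weight_ofE // /casimir_eigenvalue.
have dotZl c u v : dot (c *: u) v = c * dot u v :> R.
  by rewrite /dot -scalemxAl mxE.
have dotZr c u v : dot u (c *: v) = c * dot u v :> R.
  by rewrite dotC dotZl dotC.
have := dot_omega_rho; move: (rho R m) => r dot_omega_r.
rewrite !(dotDl, dotDr, dotZl, dotZr).
(* [dot_omega] expects the smaller index first. *)
rewrite (dotC (omega R m 2) (omega R m 1)) (dotC (omega R m m) (omega R m 1)).
rewrite (dotC (omega R m m.+1) (omega R m 1)) (dotC (omega R m m) (omega R m 2)).
rewrite (dotC (omega R m m.+1) (omega R m 2)) (dotC (omega R m m.+1) (omega R m m)).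
rewrite !dot_omega ?dot_omega_r; [|lia..].
have m0 : m%:R + 2 != 0 :> R by rewrite -natrD pnatr_eq0 addn2.
have -> : m.+2%:R = m%:R + 2 :> R by rewrite -natrD addn2.
by rewrite /casimir_formula -(natr1 m); field.
Qed.

End WeightComputations.

(** * Triangularity *)

Section LowerCombinations.
Variables (R : realType) (m a b : nat).
Hypothesis m2 : (2 < m)%N.

(** Needed because [Qfun] and [qcomp] are compared only for [k <= a]; at [k = a] the component
    [a + 1] has coefficient 0. *)
Lemma radial_casimir_ext (G G' : nat -> R -> R -> R) k (t1 t2 : R) :
  (k <= a)%N -> (forall j, (j <= a)%N -> G j = G' j) ->
  radial_casimir m a b G k t1 t2 = radial_casimir m a b G' k t1 t2.
Proof.
move=> ka GG'; rewrite /radial_casimir (GG' k) //.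
rewrite (GG' k.-1) ?(leq_trans (leq_pred k)) //.
move: ka; rewrite leq_eqVlt => /orP[/eqP ->|ka]; last by rewrite GG'.
by rewrite subrr mulr0 !mul0r.
Qed.

Lemma Qfun_qcomp i d1 d2 k : (i <= a)%N -> (k <= a)%N ->
  Qfun a b (weight_of R m a b (i, d1, d2)) k =
  qcomp a b ('C(a, i)%:R^-1) d1 d2 0 i k.
Proof.
move=> ia ka; apply/funext => t1; apply/funext => t2.
rewrite Qfun_weight_of // /qcomp.
have C0 : 'C(a, i)%:R != 0 :> R by rewrite pnatr_eq0 -lt0n bin_gt0.
by rewrite (mulrCA _ (symm _ _ _ _)) -q_fun_elem // [RHS]mulrCA mulKf.
Qed.

(** Strictness comes from the uniqueness of the triple of a weight. *)
Lemma prec_weight_of i d1 d2 i' d1' d2' : (i <= a)%N -> (i' <= a)%N ->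
  (i', d1', d2') <> (i, d1, d2) ->
  root_cone (weight_of R m a b (i, d1, d2) - weight_of R m a b (i', d1', d2')) ->
  prec (weight_of R m a b (i', d1', d2')) (weight_of R m a b (i, d1, d2)) /\
  PGplus a b (weight_of R m a b (i', d1', d2')).
Proof.
move=> ia i'a neq cone; split; last by exists i', d1', d2'.
split=> // e; apply: neq.
exact: (@weight_of_inj R m a b (i', d1', d2') (i, d1, d2)).
Qed.

Variable lam : 'rV[R]_m.+2.
Local Notation S := [set l | prec l lam /\ PGplus a b l].

(** The coefficients are chosen before [k], [t1] and [t2]. Closure under linear combinations reduces
    triangularity to single terms. *)
Definition lower_comb (g : nat -> R -> R -> R) : Prop :=
  exists coef : 'rV[R]_m.+2 -> R, forall k t1 t2,
    (k <= a)%N -> regular t1 t2 ->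
    g k t1 t2 = \sum_(l \in S) coef l * Qfun a b l k t1 t2.

Lemma lower_comb_ext g h :
  (forall k t1 t2, (k <= a)%N -> regular t1 t2 -> g k t1 t2 = h k t1 t2) ->
  lower_comb h -> lower_comb g.
Proof. by move=> gh [c hE]; exists c => k t1 t2 ka reg; rewrite gh // hE. Qed.

Lemma lower_comb0 : lower_comb (fun _ _ _ => 0).
Proof.
by exists (fun=> 0) => k t1 t2 _ _; rewrite fsbig1 // => l _; rewrite mul0r.
Qed.

Lemma lower_combD g h : lower_comb g -> lower_comb h ->
  lower_comb (fun k t1 t2 => g k t1 t2 + h k t1 t2).
Proof.
move=> [c gE] [d hE]; exists (fun l => c l + d l) => k t1 t2 ka reg.
(* Splitting the sum requires that only finitely many weights lie below [lam]. *)
rewrite gE // hE // -fsbig_split; last exact: finite_PGplus_prec.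
by apply: eq_fsbigr => l _; rewrite mulrDl.
Qed.

Lemma lower_combZ (C : R) g : lower_comb g ->
  lower_comb (fun k t1 t2 => C * g k t1 t2).
Proof.
move=> [c gE]; exists (fun l => C * c l) => k t1 t2 ka reg.
by rewrite gE // mulr_fsumr; apply: eq_fsbigr => l _; rewrite mulrA.
Qed.

Lemma lower_comb_Qfun l : S l -> lower_comb (Qfun a b l).
Proof.
move=> Sl; exists (fun l' => (l' == l)%:R) => k t1 t2 _ _.
rewrite (fsbigD1 l) //=; last exact: finite_PGplus_prec.
rewrite eqxx mul1r fsbig1 ?addr0 // => l' [_ /eqP/negbTE ->].
by rewrite mul0r.
Qed.

(** Either [i > a] and the function vanishes by degree, or it is a multiple of some [Qfun]. *)
Lemma lower_comb_qcomp (N : R) d1 d2 i :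
  ((i <= a)%N -> S (weight_of R m a b (i, d1, d2))) ->
  lower_comb (qcomp a b N d1 d2 0 i).
Proof.
move=> Sw; have [ia|ai] := leqP i a; last first.
  apply: lower_comb_ext lower_comb0 => k t1 t2 ka _.
  by rewrite /qcomp elem_gt ?subnKC // !mulr0.
apply: (lower_comb_ext _ (lower_combZ (N * 'C(a, i)%:R)
  (lower_comb_Qfun (Sw ia)))) => k t1 t2 ka _.
have C0 : 'C(a, i)%:R != 0 :> R by rewrite pnatr_eq0 -lt0n bin_gt0.
by rewrite Qfun_qcomp // /qcomp [RHS]mulrA mulfK.
Qed.

End LowerCombinations.

(** * The seven lower terms *)

Section LowerTerms.
Variables (R : realType) (m a b : nat) (N : R) (i d1 d2 : nat).
Hypotheses (m2 : (2 < m)%N) (ia : (i <= a)%N).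
Local Notation lower := (lower_comb a b (weight_of R m a b (i, d1, d2))).
Local Notation e := (eps R m).

(** [v] presents the difference of the two weights as a sum of positive roots. *)
Lemma lower_qcomp (v : 'rV[R]_m.+2) j e1 e2 : root_cone v ->
  (j, e1, e2) <> (i, d1, d2) ->
  (i%:R - j%:R) *: (e 2 - e m.+2) + (d1%:R - e1%:R) *: (e 1 - e m.+2)
  + (d2%:R - e2%:R) *: (e 1 + e 2 - e m.+1 - e m.+2) = v ->
  lower (qcomp a b N e1 e2 0 j).
Proof.
move=> cone neq vE; apply: lower_comb_qcomp => // ja.
by apply: prec_weight_of => //; rewrite weight_of_sub ?vE //; lia.
Qed.

End LowerTerms.

Section LowerTermsCases.
Variables (R : realType) (m a b : nat) (N : R) (i d1 d2 : nat).
Hypotheses (m2 : (2 < m)%N) (ia : (i <= a)%N).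
Local Notation lower := (lower_comb a b (weight_of R m a b (i, d1, d2))).
Local Notation e := (eps R m).

Lemma lower_pred_i : lower (qcomp a b N d1 d2 1 i).
Proof.
case: i ia => [|j] ja.
  apply: lower_comb_ext (lower_comb0 _ _ _ ) => k t1 t2 _ _.
  by rewrite /qcomp elem_lt // !mulr0.
apply: (@lower_comb_ext _ _ _ _ _ _ (qcomp a b N d1 d2 0 j)).
  by move=> k t1 t2 _ _; rewrite /qcomp elemS.
apply: (@lower_qcomp _ _ _ _ _ _ _ _ m2 _ (e 2 - e m.+2)) => //.
- by apply: root_cone_eps; lia.
- by case; lia.
- by apply/rowP => c; rewrite !mxE; ring.
Qed.

Lemma lower_pred_i_pred_d1 :
  lower (fun k t1 t2 => d1%:R * qcomp a b N d1.-1 d2.+1 1 i k t1 t2).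
Proof.
case: d1 => [|e1].
  by apply: lower_comb_ext (lower_comb0 _ _ _ ) => k t1 t2 _ _; rewrite mul0r.
apply: lower_combZ => //; case: i ia => [|j] ja.
  apply: lower_comb_ext (lower_comb0 _ _ _ ) => k t1 t2 _ _.
  by rewrite /qcomp elem_lt // !mulr0.
apply: (@lower_comb_ext _ _ _ _ _ _ (qcomp a b N e1 d2.+1 0 j)).
  by move=> k t1 t2 _ _; rewrite /qcomp elemS.
apply: (@lower_qcomp _ _ _ _ _ _ _ _ m2 _ (e m.+1 - e m.+2)) => //.
- by apply: root_cone_eps; lia.
- by case; lia.
- by apply/rowP => c; rewrite !mxE; ring.
Qed.

Lemma lower_succ_i_pred_d1 :
  lower (fun k t1 t2 => d1%:R * qcomp a b N d1.-1 d2 0 i.+1 k t1 t2).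
Proof.
case: d1 => [|e1].
  by apply: lower_comb_ext (lower_comb0 _ _ _ ) => k t1 t2 _ _; rewrite mul0r.
apply: lower_combZ => //.
apply: (@lower_qcomp _ _ _ _ _ _ _ _ m2 _ (e 1 - e 2)) => //.
- by apply: root_cone_eps; lia.
- by case; lia.
- by apply/rowP => c; rewrite !mxE; ring.
Qed.

Lemma lower_pred2_d1 : lower (fun k t1 t2 =>
  d1%:R * (d1.-1%:R * qcomp a b N d1.-2 d2.+1 0 i k t1 t2)).
Proof.
case: d1 => [|[|e1]].
- by apply: lower_comb_ext (lower_comb0 _ _ _ ) => k t1 t2 _ _; rewrite mul0r.
- apply: lower_comb_ext (lower_comb0 _ _ _ ) => k t1 t2 _ _.
  by rewrite mul0r mulr0.
apply: lower_combZ => //; apply: lower_combZ => //.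
(* Here [2 lambda_1 - lambda_2 = alpha_1 + alpha_(m+1)]. *)
apply: (@lower_qcomp _ _ _ _ _ _ _ _ m2 _
  ((e 1 - e 2) + (e m.+1 - e m.+2))) => //.
- by apply: root_coneD; apply: root_cone_eps; lia.
- by case; lia.
- by apply/rowP => c; rewrite !mxE; ring.
Qed.

Lemma lower_succ_i_pred_d2 :
  lower (fun k t1 t2 => d2%:R * qcomp a b N d1 d2.-1 0 i.+1 k t1 t2).
Proof.
case: d2 => [|e2].
  by apply: lower_comb_ext (lower_comb0 _ _ _ ) => k t1 t2 _ _; rewrite mul0r.
apply: lower_combZ => //.
apply: (@lower_qcomp _ _ _ _ _ _ _ _ m2 _ (e 1 - e m.+1)) => //.
- by apply: root_cone_eps; lia.
- by case; lia.
- by apply/rowP => c; rewrite !mxE; ring.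
Qed.

Lemma lower_succ_d1_pred_d2 :
  lower (fun k t1 t2 => d2%:R * qcomp a b N d1.+1 d2.-1 0 i k t1 t2).
Proof.
case: d2 => [|e2].
  by apply: lower_comb_ext (lower_comb0 _ _ _ ) => k t1 t2 _ _; rewrite mul0r.
apply: lower_combZ => //.
apply: (@lower_qcomp _ _ _ _ _ _ _ _ m2 _ (e 2 - e m.+1)) => //.
- by apply: root_cone_eps; lia.
- by case; lia.
- by apply/rowP => c; rewrite !mxE; ring.
Qed.

Lemma lower_pred_d1 :
  lower (fun k t1 t2 => d1%:R * qcomp a b N d1.-1 d2 0 i k t1 t2).
Proof.
case: d1 => [|e1].
  by apply: lower_comb_ext (lower_comb0 _ _ _ ) => k t1 t2 _ _; rewrite mul0r.
apply: lower_combZ => //.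
apply: (@lower_qcomp _ _ _ _ _ _ _ _ m2 _ (e 1 - e m.+2)) => //.
- by apply: root_cone_eps; lia.
- by case; lia.
- by apply/rowP => c; rewrite !mxE; ring.
Qed.

End LowerTermsCases.

Theorem proposition8p2 (R : realType) (m : nat) (hm : (2 < m)%N) (a b : nat)
    (lam : 'rV[R]_m.+2) (hlam : PGplus a b lam) :
  exists coef : 'rV[R]_m.+2 -> R,
    forall (k : nat) (t1 t2 : R), (k <= a)%N -> regular t1 t2 ->
      radial_casimir m a b (Qfun a b lam) k t1 t2
      = casimir_eigenvalue lam * Qfun a b lam k t1 t2
        + \sum_(lam' \in [set l | prec l lam /\ PGplus a b l])
            coef lam' * Qfun a b lam' k t1 t2.
Proof.
have [i [d1 [d2 [ia lamE]]]] := hlam.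
pose N : R := 'C(a, i)%:R^-1.
suff [c cE] : lower_comb a b lam (fun k t1 t2 =>
    radial_casimir m a b (qcomp a b N d1 d2 0 i) k t1 t2 -
    casimir_eigenvalue lam * qcomp a b N d1 d2 0 i k t1 t2).
  exists c => k t1 t2 ka reg; rewrite -cE // [in Qfun a b lam k]lamE.
  rewrite Qfun_qcomp // addrC subrK; apply: radial_casimir_ext => // j ja.
  by rewrite lamE Qfun_qcomp.
rewrite lamE casimir_eigenvalueE //.
(* The combination to be decomposed stays a metavariable until [reflexivity] fills it with the seven
   terms left after cancelling the eigenvalue term. *)
apply: lower_comb_ext.
  move=> k t1 t2 ka reg.
  have m0 : (0 < m)%N by lia.
  rewrite (radial_casimir_qcomp b N d1 d2 i m0 ka reg) [LHS]addrC addKr.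
  by reflexivity.
do 6?[apply: lower_combD => //]; apply: lower_combZ => //.
- exact: lower_pred_i_pred_d1.
- exact: lower_succ_i_pred_d1.
- exact: lower_pred2_d1.
- exact: lower_succ_i_pred_d2.
- exact: lower_pred_i.
- exact: lower_succ_d1_pred_d2.
- exact: lower_pred_d1.
Qed.
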